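(* Let $S$ be a countable, discrete, bicancellative, and left amenable semigroup, $X$ a separable locally compact metric space, and $S \curvearrowright X$ an action by proper maps. The following are equivalent: (1) $S \curvearrowright X$ is continuously pointwise ergodic and vanishes at infinity. (2) $C_0(X) = \operatorname{Fix}(\kappa) \oplus \overline{\operatorname{Cob}}(\kappa)$. (3) $S \curvearrowright X$ is uniform. (4) $M(X) = \operatorname{Fix}(\kappa^* ) \oplus \overline{\operatorname{Cob}}^{*}(\kappa^* )$. (5) $S \curvearrowright X$ is weak* mean continuous. Fix any left F{\o}lner sequence $(F_n)_n$. If any of these holds, then: (i) The mean ergodic projection $P\colon C_0(X) \to \operatorname{Fix}(\kappa)$ is given by $Pf = \lim_n A_{F_n}f$ (uniform norm) for $f \in C_0(X)$. (ii) The dual mean ergodic projection $P^*\colon M(X) \to \operatorname{Fix}(\kappa^* )$ is given by $P^*\nu = \operatorname{w*-}\lim_n A^*_{F_n}\nu$ for $\nu \in M(X)$.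
   Context: $C_0(X)$ is the Banach space (sup norm) of continuous $f\colon X\to\mathbb R$ such that $\{|f|\ge\epsilon\}$ is compact for every $\epsilon>0$; $M(X)$ is the space of finite signed regular Borel measures, identified with $C_0(X)^*$ via $\langle f,\nu\rangle=\int f\,d\nu$, with weak* topology $\sigma(M(X),C_0(X))$; $\operatorname{w*-}\lim$ is the weak* limit. $M_1^+(X)$ and $M_{\le1}^+(X)$ are the sets of non-negative measures of total mass $1$, respectively at most $1$. An action by proper maps is a map $(s,x)\mapsto sx$ with $(st)x=s(tx)$ and each $x\mapsto sx$ continuous and proper (preimages of compact sets are compact). $Sx=\{sx:s\in S\}$, with closure $\operatorname{cl}_X(Sx)$. $s_*\nu(A)=\nu(s^{-1}A)$; $\nu$ is $S$-invariant if $s_*\nu=\nu$ for all $s$. $M_1^+(\cdot,S)$, $M^+_{\le1}(\cdot,S)$ denote $S$-invariant probability/subprobability measures (those on a closed invariant set are viewed as measures on $X$ supported in that set). A point $x$ escapes to infinity if $\operatorname{cl}_X(Sx)$ is not compact. The action is pointwise uniquely ergodic if $M_1^+(\operatorname{cl}_X(Sx),S)$ is empty for every $x$ escaping to infinity and a singleton $\{\mu_x\}$ for every other $x$; then $\Phi\colon X\to M_{\le1}^+(X,S)$ is $\Phi(x)=0$ if $x$ escapes to infinity, $\Phi(x)=\mu_x$ otherwise. It is continuously pointwise ergodic if it is pointwise uniquely ergodic and $\Phi$ is weak* continuous; such an action vanishes at infinity if $x\mapsto\int f\,d\Phi(x)$ belongs to $C_0(X)$ for every $f\in C_0(X)$.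 Koopman representation: $(\kappa(s)f)(x)=f(sx)$ on $C_0(X)$; dual: $\kappa^*(s)\nu=s_*\nu$ on $M(X)$. $\operatorname{Fix}$ denotes the subspace of vectors fixed by all $\kappa(s)$ (resp. $\kappa^*(s)$). $\operatorname{Cob}(\kappa)=\operatorname{span}\{f-\kappa(s)f: f\in C_0(X),s\in S\}$ with norm closure $\overline{\operatorname{Cob}}(\kappa)$; $\operatorname{Cob}(\kappa^* )=\operatorname{span}\{\nu-\kappa^*(s)\nu:\nu\in M(X),s\in S\}$ with weak* closure $\overline{\operatorname{Cob}}^{*}(\kappa^* )$. When $C_0(X)=\operatorname{Fix}(\kappa)\oplus\overline{\operatorname{Cob}}(\kappa)$, the mean ergodic projection $P$ is the bounded projection with range $\operatorname{Fix}(\kappa)$ and kernel $\overline{\operatorname{Cob}}(\kappa)$, and the dual mean ergodic projection is its adjoint $P^*$. $S$ is bicancellative if $t_1s=t_2s$ or $st_1=st_2$ implies $t_1=t_2$. A sequence $(F_n)_n$ of non-empty finite subsets of $S$ is left F{\o}lner if $\lim_n|sF_n\Delta F_n|/|F_n|=0$ for every $s\in S$; the bicancellative semigroup $S$ is left amenable if such a sequence exists. For non-empty finite $F\subseteq S$, $A_F=\frac1{|F|}\sum_{t\in F}\kappa(t)$ and $A_F^*=\frac1{|F|}\sum_{t\in F}\kappa^*(t)$. The action is uniform if for every left F{\o}lner sequence $(F_n)_n$ and every $f\in C_0(X)$ the limit $\lim_nA_{F_n}f$ exists in the uniform norm. It is weak* mean continuous if for every left F{\o}lner sequence $(F_n)_n$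 the map $\nu\in M_{\le1}^+(X)\mapsto\operatorname{w*-}\lim_nA_{F_n}^*\nu$ is well-defined (the limits exist) and weak*-to-weak* continuous. *)

(* Defs.v *)
From HB Require Import structures.
From mathcomp Require Import all_boot all_order all_algebra finmap.
From mathcomp Require Import all_classical all_reals all_analysis.

Set Implicit Arguments.
Unset Strict Implicit.
Unset Printing Implicit Defensive.

Import Order.TTheory GRing.Theory Num.Theory.
Import numFieldNormedType.Exports.

Local Open Scope classical_set_scope.
Local Open Scope ring_scope.

(* Metric spaces with a base point.  The base point plays no role: it is only
   there because the library's measurable types are inhabited by design. *)
#[short(type="pmetricType")]
HB.structure Definition PMetric (K : numDomainType) :=
  {M of Pointed M & Metric K M}.

Definition separable_space (T : topologicalType) :=
  exists2 D : set T, countable D & dense D.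

Section LinearAlgebra.
Context (R : pzRingType) (V : lmodType R).

Definition linear_span (A : set V) : set V :=
  [set v | exists n (c : 'I_n -> R) (w : 'I_n -> V),
     (forall i, A (w i)) /\ v = \sum_(i < n) c i *: w i].

Definition is_direct_sum (A B : set V) : Prop :=
  [set a + b | a in A & b in B] = [set: V] /\ A `&` B = [set 0].

End LinearAlgebra.

Section Semigroups.
Context (S : semigroupType).

Definition bicancellative : Prop := forall s t1 t2 : S,
  (t1 * s = t2 * s)%g \/ (s * t1 = s * t2)%g -> t1 = t2.

Definition fsymdiff (A B : {fset S}) : {fset S} :=
  ((A `\` B) `|` (B `\` A))%fset.

Definition left_folner (R : realType) (F : nat -> {fset S}) : Prop :=
  (forall n, F n != fset0) /\
  forall s : S,
    (#|` fsymdiff [fset (s * t)%g | t in F n]%fset (F n)|%:R / #|` F n|%:R : R)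
      @[n --> \oo] --> (0 : R).

Definition left_amenable (R : realType) : Prop :=
  exists F : nat -> {fset S}, left_folner R F.

Definition average (R : realType) (V : lmodType R) (T : S -> V -> V)
    (F : {fset S}) (v : V) : V :=
  #|` F|%:R^-1 *: \sum_(t <- F) T t v.

End Semigroups.

Record proper_action (S : semigroupType) (X : topologicalType) := ProperAction {
  act :> S -> X -> X ;
  actM : forall s t x, act (s * t)%g x = act s (act t x) ;
  act_continuous : forall s, continuous (act s) ;
  act_proper : forall s K, compact K -> compact (act s @^-1` K) }.

Section C0.
Context (R : realType) (X : topologicalType).

Definition vanishing_continuous (f : X -> R) : Prop :=
  continuous f /\ forall e : R, 0 < e -> compact [set x | e <= `|f x|].

Definition C0_pred : {pred (X -> R)} := fun f => `[< vanishing_continuous f >].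

Record C0 := MkC0 { C0_fun :> X -> R ; _ : C0_fun \in C0_pred }.

HB.instance Definition _ := [isSub for C0_fun].
HB.instance Definition _ := [Choice of C0 by <:].

Lemma C0P (f : C0) : vanishing_continuous f.
Proof. by apply/asboolP; exact: (valP f). Qed.

Lemma compact_superlevel (f : X -> R) (e : R) (K : set X) :
  continuous f -> compact K -> [set x | e <= `|f x|] `<=` K ->
  compact [set x | e <= `|f x|].
Proof.
move=> cf cK; apply: subclosed_compact => //.
have -> : [set x | e <= `|f x|] = (fun x => `|f x|) @^-1` [set y | e <= y] by [].
apply: preimage_closed; last exact: closed_ge.
by move=> x _; apply: continuous_comp; [exact: cf|exact: norm_continuous].
Qed.

Fact C0_submod_closed : submod_closed C0_pred.
Proof.
split.
  apply/asboolP; split => [|e e0]; first by move=> x; exact: cvg_cst.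
  rewrite [X in compact X](_ : _ = set0); first exact: compact0.
  by rewrite -subset0 => x /=; rewrite normr0 leNgt e0.
move=> a f g /asboolP[cf vf] /asboolP[cg vg]; apply/asboolP.
have cfg : continuous (a *: f + g : X -> R).
  by move=> x; apply: cvgD; [apply: cvgZr; exact: cf|exact: cg].
split=> // e e0; have e20 : 0 < e / 2 by rewrite divr_gt0.
have b0 : 0 < `|a| + 1 by rewrite ltr_wpDl.
apply: (compact_superlevel cfg (compactU (vf (e / 2 / (`|a| + 1)) _) (vg _ e20))).
  by rewrite divr_gt0.
move=> x /= efg; have [|gx] := leP (e / 2) `|g x|; [by right|left].
rewrite ler_pdivrMr// leNgt; apply/negP => fx.
suff : `|a * f x + g x| < e by rewrite ltNge efg.
rewrite (le_lt_trans (ler_normD _ _))// (splitr e) ltrD//.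
rewrite normrM (le_lt_trans _ fx)// mulrC ler_wpM2l//.
by rewrite lerDl.
Qed.

HB.instance Definition _ :=
  GRing.isSubmodClosed.Build R (X -> R) C0_pred C0_submod_closed.
HB.instance Definition _ := [SubChoice_isSubLmodule of C0 by <:].

Lemma C0_bounded (f : C0) : has_ubound (range (fun x => `|f x|)).
Proof.
have [cf vf] := C0P f; have := vf 1 ltr01.
have [[x0 x0f]|/forallNP H _] := pselect (exists x, 1 <= `|f x|); last first.
  by exists 1 => _ [x _ <-]; rewrite leNgt; apply/negP => /ltW /H.
move=> cK; have [||c _ fc] := @compact_EVT_max _ _ (fun x => `|f x|) _ _ cK.
- by exists x0.
- apply: continuous_subspaceT => x.
  by apply: continuous_comp; [exact: cf|exact: norm_continuous].
- exists (Num.max 1 `|f c|) => _ [x _ <-]; rewrite le_max.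
  have [//|/ltW fx] := leP `|f x| 1.
  by rewrite fc ?orbT// inE.
Qed.

Definition C0_norm (f : C0) : R := sup (range (fun x => `|f x|)).

Lemma C0_norm_ub (f : C0) x : `|f x| <= C0_norm f.
Proof. by apply: ub_le_sup; [exact: C0_bounded|exists x]. Qed.

Lemma C0_norm_ge0 (f : C0) : 0 <= C0_norm f.
Proof.
have [[x _]|H] := pselect (exists x : X, True).
  exact: le_trans (C0_norm_ub f x).
rewrite /C0_norm; have -> : range (fun x => `|f x|) = set0; last by rewrite sup0.
by rewrite -subset0 => y [x _ _]; case: H; exists x.
Qed.

Lemma C0_norm_le (f : C0) (M : R) :
  0 <= M -> (forall x, `|f x| <= M) -> C0_norm f <= M.
Proof.
move=> M0 fM; have [[x _]|H] := pselect (exists x : X, True).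
  by apply: ge_sup; [exists `|f x|, x|move=> _ [y _ <-]].
rewrite /C0_norm; have -> : range (fun x => `|f x|) = set0; last by rewrite sup0.
by rewrite -subset0 => y [x _ _]; case: H; exists x.
Qed.

Fact C0_ler_normD (f g : C0) : C0_norm (f + g) <= C0_norm f + C0_norm g.
Proof.
apply: C0_norm_le => [|x]; first by rewrite addr_ge0// C0_norm_ge0.
by rewrite (le_trans (ler_normD _ _))// lerD// C0_norm_ub.
Qed.

Fact C0_normrZ (a : R) (f : C0) : C0_norm (a *: f) = `|a| * C0_norm f.
Proof.
have leZ (b : R) (h : C0) : C0_norm (b *: h) <= `|b| * C0_norm h.
  apply: C0_norm_le => [|x]; first by rewrite mulr_ge0// C0_norm_ge0.
  by rewrite normrM ler_wpM2l// C0_norm_ub.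
apply/eqP; rewrite eq_le leZ/=.
have [->|a0] := eqVneq a 0; first by rewrite normr0 mul0r C0_norm_ge0.
have {1}-> : f = a^-1 *: (a *: f) by rewrite scalerA mulVf// scale1r.
rewrite -ler_pdivlMl ?normr_gt0// -normfV; exact: leZ.
Qed.

Fact C0_normr0_eq0 (f : C0) : C0_norm f = 0 -> f = 0.
Proof.
move=> f0; apply/val_inj/funext => x; apply/eqP.
by rewrite -normr_eq0 eq_le normr_ge0 andbT -f0 C0_norm_ub.
Qed.

HB.instance Definition _ :=
  Lmodule_isNormed.Build R C0 C0_ler_normD C0_normrZ C0_normr0_eq0.

End C0.
Arguments C0 : clear implicits.

Section Measures.
Context (R : realType) (X : pmetricType R).

Definition borel := g_sigma_algebraType (@open X).

(* For a signed measure this is equivalent to the regularity of its total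
   variation v, because sup_C |nu C| <= v B <= 2 sup_C |nu C|, for C ranging
   over the measurable subsets of B. *)
Definition regular_set_function (nu : set borel -> R) : Prop :=
  forall (A : set borel) (e : R), measurable A -> 0 < e ->
  exists K U : set X, [/\ compact K, open U, K `<=` A, A `<=` U &
    forall B : set borel, measurable B -> B `<=` U `\` K -> `|nu B| < e].

(* Signed measures are set functions on the Borel sets; they are extended by 0
   to the other sets, so that two of them are equal as soon as they agree on
   the Borel sets. *)
Definition is_signed_measure (nu : set borel -> R) : Prop :=
  [/\ forall A, ~ measurable A -> nu A = 0,
      nu set0 = 0,
      semi_sigma_additive (fun A => (nu A)%:E) &
      regular_set_function nu].

Definition signed_measure_pred : {pred (set borel -> R)} :=
  fun nu => `[< is_signed_measure nu >].

Record signed_measure := MkSignedMeasure {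
  measure_fun :> set borel -> R ; _ : measure_fun \in signed_measure_pred }.

HB.instance Definition _ := [isSub for measure_fun].
HB.instance Definition _ := [Choice of signed_measure by <:].

Lemma signed_measureP (nu : signed_measure) : is_signed_measure nu.
Proof. by apply/asboolP; exact: (valP nu). Qed.

Definition charge_of (nu : signed_measure) (A : set borel) : \bar R := (nu A)%:E.

Section ChargeOf.
Variable nu : signed_measure.

Let charge_of0 : charge_of nu set0 = 0%E.
Proof. by have [_ nu0 _ _] := signed_measureP nu; rewrite /charge_of nu0. Qed.

Let charge_of_finite A : measurable A -> charge_of nu A \is a fin_num.
Proof. by []. Qed.

Let charge_of_sigma_additive : semi_sigma_additive (charge_of nu).
Proof. by have [] := signed_measureP nu. Qed.

HB.instance Definition _ := isCharge.Build _ borel R (charge_of nu)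
  charge_of0 charge_of_finite charge_of_sigma_additive.

End ChargeOf.

Fact signed_measure_submod_closed : submod_closed signed_measure_pred.
Proof.
split.
  apply/asboolP; split => //.
  - move=> F _ _ _; rewrite [X in X @ _ --> _](_ : _ = cst 0%E).
      exact: cvg_cst.
    by apply/funext => n; rewrite big1.
  - move=> A e _ e0; exists set0, setT.
    by split => //; [exact: compact0|exact: openT|move=> B _ _; rewrite normr0].
move=> a f g pf pg; apply/asboolP.
have /asboolP[f0 fs0 _ rf] := pf; have /asboolP[g0 gs0 _ rg] := pg; split.
- by move=> A mA; change (a * f A + g A = 0); rewrite f0// g0// mulr0 addr0.
- by change (a * f set0 + g set0 = 0); rewrite fs0 gs0 mulr0 addr0.
- pose cf : {charge set borel -> \bar R} := charge_of (MkSignedMeasure pf).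
  pose cg : {charge set borel -> \bar R} := charge_of (MkSignedMeasure pg).
  move=> G mG tG mUG.
  exact: (@charge_semi_sigma_additive _ _ _ (cadd (cscale a cf) cg)).
move=> A e mA e0; have e20 : 0 < e / 2 by rewrite divr_gt0.
have b0 : 0 < `|a| + 1 by rewrite ltr_wpDl.
have [K1 [U1 [cK1 oU1 K1A AU1 h1]]] := rf A _ mA (divr_gt0 e20 b0).
have [K2 [U2 [cK2 oU2 K2A AU2 h2]]] := rg A _ mA e20.
exists (K1 `|` K2), (U1 `&` U2); split.
- exact: compactU.
- exact: openI.
- by rewrite subUset.
- by rewrite subsetI.
move=> B mB BUK.
have /h1 : B `<=` U1 `\` K1 by move=> x /BUK[[? ?] /not_orP[]].
have /h2 : B `<=` U2 `\` K2 by move=> x /BUK[[? ?] /not_orP[]].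
move=> /(_ mB) gB /(_ mB) fB.
change (`|a * f B + g B| < e); rewrite (le_lt_trans (ler_normD _ _))//.
rewrite (splitr e) ler_ltD//.
rewrite normrM; move: (ltW fB); rewrite ler_pdivlMr//; apply: le_trans.
by rewrite mulrC ler_wpM2l// lerDl.
Qed.

HB.instance Definition _ := GRing.isSubmodClosed.Build R (set borel -> R)
  signed_measure_pred signed_measure_submod_closed.
HB.instance Definition _ := [SubChoice_isSubLmodule of signed_measure by <:].

Lemma hahn_ex (nu : signed_measure) :
  {PN : set borel * set borel | hahn_decomposition (charge_of nu) PN.1 PN.2}.
Proof.
by apply: cid; have [P [N PN]] := Hahn_decomposition (charge_of nu); exists (P, N).
Qed.

Definition integral_signed (f : X -> R) (nu : signed_measure) : R :=
  Rintegral (jordan_pos (svalP (hahn_ex nu))) [set: borel] f -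
  Rintegral (jordan_neg (svalP (hahn_ex nu))) [set: borel] f.

(* The weak* topology sigma(M(X), C_0(X)). *)
HB.instance Definition _ := Topological.copy signed_measure
  (initial_topology (fun nu : signed_measure =>
     (fun f : C0 R X => integral_signed f nu) : {ptws C0 R X -> R})).

Definition nonnegative (nu : signed_measure) : Prop := forall A, 0 <= nu A.

Definition subprobabilities : set signed_measure :=
  [set nu | nonnegative nu /\ nu setT <= 1].

Definition probabilities : set signed_measure :=
  [set nu | nonnegative nu /\ nu setT = 1].

End Measures.

Section Koopman.
Context (R : realType) (S : semigroupType) (X : pmetricType R)
  (a : proper_action S X).

Fact koopman_subproof (s : S) (f : C0 R X) :
  ((fun x => f (a s x)) : X -> R) \in @C0_pred R X.
Proof.
have [cf vf] := C0P f; apply/asboolP; split=> [x|e e0].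
  by apply: continuous_comp; [exact: act_continuous|exact: cf].
exact: act_proper (vf e e0).
Qed.

Definition koopman (s : S) (f : C0 R X) : C0 R X := MkC0 (koopman_subproof s f).

Lemma borel_open (U : set X) : open U -> measurable (U : set (borel X)).
Proof. exact: sub_sigma_algebra. Qed.

Lemma borel_compact (K : set X) : compact K -> measurable (K : set (borel X)).
Proof.
move=> /(compact_closed (@metric_hausdorff R X)) cK.
by rewrite -[K]setCK; apply: measurableC; apply: borel_open; exact: closed_openC.
Qed.

Lemma borel_continuous (h : X -> X) : continuous h ->
  measurable_fun [set: borel X] (h : borel X -> borel X).
Proof.
move=> /continuousP ch; apply: (@measurability _ _ (borel X) (borel X) _ _ (@open X) erefl).
by move=> _ [U oU <-]; rewrite setTI; apply: borel_open; exact: ch.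
Qed.

(* The push-forward of nu along the action of s, extended by 0 to the
   non-Borel sets. *)
Definition koopman_dual_fun (s : S) (nu : signed_measure X)
    (A : set (borel X)) : R :=
  if `[< measurable A >] then nu (a s @^-1` A) else 0.

Fact koopman_dual_subproof (s : S) (nu : signed_measure X) :
  koopman_dual_fun s nu \in @signed_measure_pred R X.
Proof.
have mh := borel_continuous (@act_continuous _ _ a s).
have mpre (A : set (borel X)) : measurable A -> measurable (a s @^-1` A : set (borel X)).
  by move=> mA; rewrite -[X in measurable X]setTI; exact: mh.
have dE (A : set (borel X)) : measurable A -> koopman_dual_fun s nu A = nu (a s @^-1` A).
  by move=> mA; rewrite /koopman_dual_fun asboolT.
have [_ nu0 _ rnu] := signed_measureP nu.
apply/asboolP; split.
- by move=> A mA; rewrite /koopman_dual_fun asboolF.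
- by rewrite dE// preimage_set0.
- move=> F mF tF mUF; rewrite dE//.
  under eq_fun do under eq_bigr do rewrite dE//.
  rewrite preimage_bigcup.
  apply: (@charge_semi_sigma_additive _ _ _ (charge_of nu)).
  + by move=> n; exact: mpre.
  + apply/trivIsetP => /= i j _ _ ij; rewrite -preimage_setI.
    by move/trivIsetP : tF => /(_ _ _ _ _ ij) ->//; rewrite preimage_set0.
  + by rewrite -preimage_bigcup; exact: mpre.
move=> A e mA e0; have e20 : 0 < e / 2 by rewrite divr_gt0.
have [K [U [cK _ KA AU hK]]] := rnu _ _ (mpre _ mA) e20.
have [L [V [cL _ LA AV hL]]] := rnu _ _ (mpre _ (measurableC mA)) e20.
have image_compact C : compact C -> compact (a s @` C).
  by move=> cC; apply: continuous_compact => //; apply: continuous_subspaceT;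
    exact: act_continuous.
exists (a s @` K), (~` (a s @` L)); split.
- exact: image_compact.
- by apply: closed_openC; apply: compact_closed (image_compact _ cL);
    exact: metric_hausdorff.
- by move=> _ [x Kx <-]; exact: KA.
- by move=> y Ay [x Lx xy]; apply: (LA _ Lx); rewrite /= xy.
move=> B mB BLK; rewrite dE//.
have -> : nu (a s @^-1` B) = nu (a s @^-1` (B `&` A)) + nu (a s @^-1` (B `\` A)).
  apply: EFin_inj; rewrite addrC EFinD.
  exact: (chargeDI (charge_of nu) (mpre _ mB) (mpre _ mA)).
rewrite (le_lt_trans (ler_normD _ _))// (splitr e) ltrD//.
- apply: hK; first by apply: mpre; exact: measurableI.
  move=> x [Bx Ax]; split; first exact: AU.
  by move=> Kx; have [_] := BLK _ Bx; apply; exists x.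
- apply: hL; first by apply: mpre; exact: measurableD.
  move=> x [Bx Ax]; split; first exact: AV.
  by move=> Lx; have [+ _] := BLK _ Bx; apply; exists x.
Qed.

Definition koopman_dual (s : S) (nu : signed_measure X) : signed_measure X :=
  MkSignedMeasure (koopman_dual_subproof s nu).

Definition koopman_fix : set (C0 R X) := [set f | forall s, koopman s f = f].

Definition koopman_dual_fix : set (signed_measure X) :=
  [set nu | forall s, koopman_dual s nu = nu].

Definition koopman_cob : set (C0 R X) :=
  linear_span [set g | exists f s, g = f - koopman s f].

Definition koopman_dual_cob : set (signed_measure X) :=
  linear_span [set mu | exists nu s, mu = nu - koopman_dual s nu].

Definition orbit_closure (x : X) : set X := closure (range (fun s => a s x)).

Definition escapes_to_infinity (x : X) : Prop := ~ compact (orbit_closure x).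

(* The invariant probability measures on the closed invariant set E, viewed as
   measures on X. *)
Definition invariant_probabilities (E : set X) : set (signed_measure X) :=
  [set nu | [/\ probabilities nu, koopman_dual_fix nu & nu (~` E) = 0]].

Definition pointwise_uniquely_ergodic : Prop := forall x,
  (escapes_to_infinity x -> invariant_probabilities (orbit_closure x) = set0) /\
  (~ escapes_to_infinity x ->
     exists mu, invariant_probabilities (orbit_closure x) = [set mu]).

(* The choice made by xget is only meaningful for pointwise uniquely ergodic
   actions, where it ranges over a singleton. *)
Definition ergodic_map (x : X) : signed_measure X :=
  if `[< escapes_to_infinity x >] then 0
  else xget 0 (invariant_probabilities (orbit_closure x)).

Definition continuously_pointwise_ergodic : Prop :=
  pointwise_uniquely_ergodic /\ continuous ergodic_map.

Definition vanishes_at_infinity : Prop := forall f : C0 R X,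
  vanishing_continuous (fun x => integral_signed f (ergodic_map x)).

Definition uniform_action : Prop :=
  forall F : nat -> {fset S}, left_folner R F ->
  forall f : C0 R X, cvgn (fun n => average koopman (F n) f).

Definition weak_star_mean_continuous : Prop :=
  forall F : nat -> {fset S}, left_folner R F ->
  exists L : signed_measure X -> signed_measure X,
    (forall nu, subprobabilities nu ->
       average koopman_dual (F n) nu @[n --> \oo] --> L nu) /\
    {within @subprobabilities R X, continuous L}.

Definition is_mean_ergodic_projection (P : {linear C0 R X -> C0 R X}) : Prop :=
  [/\ continuous P, forall f, P (P f) = P f, range P = koopman_fix &
      [set f | P f = 0] = closure koopman_cob].

Definition is_adjoint (P : C0 R X -> C0 R X)
    (Q : signed_measure X -> signed_measure X) : Prop :=
  forall (f : C0 R X) nu, integral_signed f (Q nu) = integral_signed (P f) nu.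

End Koopman.

(* Main.v *)
Require Import Defs.
From HB Require Import structures.
From mathcomp Require Import all_boot all_order all_algebra finmap.
From mathcomp Require Import all_classical all_reals all_analysis.
From mathcomp Require Import measurable_realfun lra zify.

Set Implicit Arguments.
Unset Strict Implicit.
Unset Printing Implicit Defensive.

Import Order.TTheory GRing.Theory Num.Theory.
Import numFieldNormedType.Exports.

Local Open Scope classical_set_scope.
Local Open Scope ring_scope.

(** All conditions are compared with uniformity of the action.

    Write A_F for the average over a finite set F of the operators on the
    functions vanishing at infinity, and A*_F for its dual on measures.  Since
    the semigroup acts on functions from the right, A_F kappa(s) = A_{sF} and
    kappa(s) A_F = A_{Fs}.  The first identity and the Folner condition show
    that averages annihilate coboundaries in the limit
    ([folner_average_coboundary]).  For the second one, F_n s is again a left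
    Folner sequence, and two left Folner sequences can be interleaved into a
    third; so if all averages converge, the limit is the same for F_n and for
    F_n s, that is, it is invariant ([folner_limit_unique]).  This gives at once
    the equivalence of uniformity with the direct sum decomposition of the
    space of functions, and the mean ergodic projection P as the limit of the
    averages ([uniform_projection]).

    The way back to uniformity is one compactness argument.  Along an
    ultrafilter, averaged point masses A*_{F_n} delta_{x_n} converge weak* to
    some invariant subprobability ([folner_limit_exists]).  If the averages of
    some f were not uniformly Cauchy, there would be two such limits eta and
    eta', along the same points x_n but for two Folner sequences, with different
    integrals of f.  Hence it suffices that any two such limits agree
    ([uniform_of_unique_limits]):
    - if the measures decompose, eta - eta' is invariant and also a weak* limit
      of coboundaries, hence 0;
    - if the action is weak* mean continuous, the limit map L of the averages
      fixes eta and eta' and takes the same value on A*_{F_n} delta_{x_n} as on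
      delta_{x_n}, so eta and eta' are both the limit of L(delta_{x_n});
    - if the action is continuously pointwise ergodic and vanishes at infinity,
      unique ergodicity makes A_{F_n} f converge pointwise to the function
      Phi f : x |-> int f dPhi(x).  This function is invariant, so dominated
      convergence yields int f deta = int Phi f deta, which is the limit of
      Phi f(x_n), and the same holds for eta'.

    Conversely, let the action be uniform.  The adjoint P* sends nu to the
    measure representing f |-> int P f dnu; it decomposes the measures and is
    weak* continuous.  Moreover P f is invariant and continuous, hence constant
    on orbit closures, so an invariant probability on the orbit closure of x
    can only be the measure representing f |-> P f(x).  If that closure is not
    compact, P f vanishes on it, because P f vanishes at infinity, and there is
    no such probability.

    The analytic input is the Riesz representation of the positive functionals
    by regular Borel measures ([riesz_representation]), and the fact that the
    functions vanishing at infinity separate the signed measures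
    ([signed_measure_ext]). *)

(** * Functions vanishing at infinity *)

Lemma additive0 (V W : zmodType) (L : V -> W) :
  (forall v w, L (v + w) = L v + L w) -> L 0 = 0.
Proof.
by move=> /(_ 0 0); rewrite addr0 => /(congr1 (fun v => v - L 0)); rewrite subrr addrK.
Qed.

Section C0_constructions.
Context {R : realType} {X : topologicalType}.
Implicit Types (f g : C0 R X).

Definition mkC0 (g : X -> R) (g0 : vanishing_continuous g) : C0 R X :=
  MkC0 (asboolT g0 : g \in @C0_pred R X).

Lemma C0_continuous f : continuous f.
Proof. by have [] := C0P f. Qed.

Lemma C0_ext f g : f =1 g -> f = g.
Proof. by move=> fg; apply/val_inj/funext. Qed.

Lemma C0_le_norm f x : `|f x| <= `|f|.
Proof. exact: C0_norm_ub. Qed.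

Lemma C0_normr_le f (M : R) : 0 <= M -> (forall x, `|f x| <= M) -> `|f| <= M.
Proof. exact: C0_norm_le. Qed.

Lemma C0_sumE I (r : seq I) (P : pred I) (F : I -> C0 R X) x :
  (\sum_(i <- r | P i) F i) x = \sum_(i <- r | P i) F i x.
Proof. by elim/big_rec2 : _ => //= i y g _ <-. Qed.

(** The source of new elements of the space: a continuous function below an
    element of it has smaller superlevel sets. *)
Lemma vanishing_continuous_dominated (g : X -> R) f : continuous g ->
  (forall x, `|g x| <= `|f x|) -> vanishing_continuous g.
Proof.
move=> cg gf; split=> // e e0; have [_ vf] := C0P f.
by apply: (compact_superlevel cg (vf e e0)) => x /= /le_trans; apply.
Qed.

Lemma C0_min_exists f (u : X -> R) : continuous u -> (forall x, 0 <= u x) ->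
  (forall x, 0 <= f x) -> exists h : C0 R X, forall x, h x = Num.min (f x) (u x).
Proof.
move=> cu u0 f0; suff H : vanishing_continuous (fun x => Num.min (f x) (u x)).
  by exists (mkC0 H).
apply: (@vanishing_continuous_dominated _ f) => [x|x].
  by apply: continuous_min; [exact: C0_continuous|exact: cu].
by rewrite !ger0_norm ?le_min ?f0 ?u0// ge_min lexx.
Qed.

End C0_constructions.

Section level_sets.
Context {R : realType} {X : topologicalType} (f : X -> R).
Hypothesis cf : continuous f.

Lemma open_superlevel c : open [set x | c < f x].
Proof. by move/continuousP : cf => /(_ [set y | c < y]); apply; exact: open_gt. Qed.

Lemma open_not_superlevel c : open (~` [set x | c <= f x]).
Proof.
rewrite (_ : ~` _ = [set x | f x < c]).
  by move/continuousP : cf => /(_ [set y | y < c]); apply; exact: open_lt.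
apply/seteqP; split=> x /= fx; first by rewrite ltNge; apply/negP.
by apply/negP; rewrite -ltNge.
Qed.

End level_sets.

Section metric_separation.
Context {R : realType} {X : pmetricType R}.

(** The distance to the complement of U, or the constant 1 if U is the whole
    space. *)
Lemma open_cozero (U : set X) : open U -> exists u : X -> R,
  [/\ continuous u, forall x, 0 <= u x, forall x, ~ U x -> u x = 0 &
      forall x, U x -> 0 < u x].
Proof.
move=> oU; have [UT|/set0P[c Uc]] := eqVneq (~` U) set0.
  exists (fun=> 1); split=> // [x|x Ux]; first exact: cvg_cst.
  by have : set0 x by rewrite -UT.
have fin x : edist_inf (~` U) x \is a fin_num.
  rewrite ge0_fin_numE ?edist_inf_ge0//; apply: (@le_lt_trans _ _ (edist (x, c))).
    by apply: ereal_inf_lbound; exists c.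
  rewrite -ge0_fin_numE ?edist_ge0//; apply/edist_finP; exists (mdist x c + 1).
    by rewrite ltr_wpDl// mdist_ge0.
  by rewrite ballEmdist /= ltrDl.
exists (fun x => fine (edist_inf (~` U) x)); split=> [x|x|x Ux|x Ux].
- by apply: fine_cvg; rewrite fineK//; exact: edist_inf_continuous.
- by rewrite fine_ge0// edist_inf_ge0.
- by rewrite edist_inf0.
- rewrite fine_gt0// -ge0_fin_numE ?edist_inf_ge0// fin andbT.
  have /nbhs_ballP[r /= r0 rU] := open_nbhs_nbhs (conj oU Ux).
  apply: (@lt_le_trans _ _ r%:E); first by rewrite lte_fin.
  apply: le_ereal_inf_tmp => _ [y Uy <-]; rewrite leNgt; apply/negP.
  by move=> /edist_lt_ball /= /rU.
Qed.

Lemma compact_cover_seq (K : set X) (O : nat -> set X) : compact K ->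
  (forall n, open (O n)) -> (forall m n, (m <= n)%N -> O m `<=` O n) ->
  K `<=` \bigcup_n O n -> exists N, K `<=` O N.
Proof.
move=> cK oO ndO KO; have cvK : cover_compact K by rewrite -compact_cover.
case: (cvK nat setT O) => // D _ KD.
exists (\max_(i <- D) i)%N => x /KD[i /= Di Oix].
by apply: ndO Oix; exact: leq_bigmax_seq.
Qed.

Lemma compact_neighborhood (K : set X) : locally_compact [set: X] -> compact K ->
  exists V C : set X, [/\ open V, compact C, K `<=` V & V `<=` C].
Proof.
move=> lcX cK.
have H x : exists V : set X * set X, [/\ open V.1, compact V.2, V.1 x & V.1 `<=` V.2].
  have [C] := lcX x Logic.I; rewrite withinET => xC [cC _].
  exists (interior C, C); split => //=; first exact: open_interior.
  exact: interior_subset.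
have [V HV] := choice H.
have cvK : cover_compact K by rewrite -compact_cover.
case: (cvK X setT (fun x => (V x).1)) => [x _|x Kx|D _ KD]; first by have [] := HV x.
  by exists x => //; have [] := HV x.
exists (\bigcup_(i in [set` D]) (V i).1), (\bigcup_(i in [set` D]) (V i).2); split => //.
- by apply: bigcup_open => i _; have [] := HV i.
- by rewrite bigcup_fset; apply: bigsetU_compact => i _; have [] := HV i.
- by move=> x [i Di Vx]; exists i => //; have [_ _ _ VC] := HV i; exact: VC.
Qed.

(** Local compactness enters here: the distance u to the complement of a
    relatively compact neighbourhood has a minimum m > 0 on K, and min(u / m, 1)
    is the required function. *)
Lemma C0_urysohn (K U : set X) : locally_compact [set: X] ->
  compact K -> open U -> K `<=` U ->
  exists g : C0 R X, [/\ forall x, 0 <= g x <= 1, forall x, K x -> g x = 1 &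
    forall x, ~ U x -> g x = 0].
Proof.
move=> lcX cK oU KU.
have [->|/set0P K0] := eqVneq K set0.
  by exists 0; split=> // x; rewrite [(0 : C0 R X) x]/= lexx ler01.
have [V [C [oV cC KV VC]]] := compact_neighborhood lcX cK.
have [u [cu u0 uF uT]] := open_cozero (openI oU oV).
have [c + cmin] := compact_EVT_min K0 cK (continuous_subspaceT cu).
rewrite inE => Kc.
have uc : 0 < u c by apply: uT; split; [exact: KU|exact: KV].
pose g x := Num.min (u x / u c) 1.
have cg : continuous g.
  move=> x; apply: (@continuous_min R X (fun x => u x / u c) (fun=> 1)).
    by apply: cvgM; [exact: cu|exact: cvg_cst].
  exact: cvg_cst.
have g01 x : 0 <= g x <= 1.
  by rewrite /g le_min ler01 ge_min lexx orbT !andbT divr_ge0// ltW.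
have gF x : ~ (U `&` V) x -> g x = 0.
  by move=> /uF ux; rewrite /g ux mul0r min_l.
have vg : vanishing_continuous g.
  split=> // e e0; apply: (compact_superlevel cg cC) => x /= egx.
  apply: VC; have [_] : (U `&` V) x; last by [].
  by apply: contrapT => /gF gx; move: egx; rewrite gx normr0 leNgt e0.
exists (mkC0 vg); split=> [//|x Kx|x Ux].
  by apply: min_r; rewrite ler_pdivlMr// mul1r cmin// inE.
by apply: gF => -[].
Qed.

End metric_separation.

(** * The measure of a positive functional *)

Section Riesz_outer_measure.
Context {R : realType} {X : pmetricType R}.
Variables (L : C0 R X -> R) (M : R).
Hypotheses (LD : forall f g, L (f + g) = L f + L g)
  (LZ : forall (a : R) f, L (a *: f) = a * L f)
  (L_ge0 : forall f : C0 R X, (forall x, 0 <= f x) -> 0 <= L f)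
  (LM : forall f, `|L f| <= M * `|f|).
Implicit Types (f g h : C0 R X) (U V : set X).

Definition subordinate f U :=
  (forall x, 0 <= f x <= 1) /\ (forall x, ~ U x -> f x = 0).

Definition open_content U : \bar R :=
  ereal_sup [set (L f)%:E | f in subordinate^~ U].

Definition riesz_outer (A : set X) : \bar R :=
  ereal_inf [set open_content U | U in [set U | open U /\ A `<=` U]].

Lemma functionalB f g : L (f - g) = L f - L g.
Proof. by rewrite -scaleN1r LD LZ mulN1r. Qed.

Lemma functional0 : L 0 = 0.
Proof. exact: additive0. Qed.

Lemma le_functional f g : (forall x, f x <= g x) -> L f <= L g.
Proof.
move=> fg; rewrite -subr_ge0 -functionalB; apply: L_ge0 => x.
by change (0 <= g x - f x); rewrite subr_ge0.
Qed.

Lemma functional_sum I (r : seq I) (P : pred I) (F : I -> C0 R X) :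
  L (\sum_(i <- r | P i) F i) = \sum_(i <- r | P i) L (F i).
Proof. exact: (big_morph L LD functional0). Qed.

Lemma subordinateS f U V : U `<=` V -> subordinate f U -> subordinate f V.
Proof. by move=> UV [f01 fU]; split=> // x nV; apply: fU => /UV. Qed.

Lemma subordinate0 U : subordinate 0 U.
Proof. by split=> // x; change (0 <= (0 : R) <= 1); rewrite lexx ler01. Qed.

Lemma open_content_ub f U : subordinate f U -> ((L f)%:E <= open_content U)%E.
Proof. by move=> fU; apply: ereal_sup_ubound; exists f. Qed.

Lemma open_content_ge0 U : (0 <= open_content U)%E.
Proof. by rewrite -[0%E]/(0%:E) -functional0; apply/open_content_ub/subordinate0. Qed.

Lemma le_open_content U V : U `<=` V -> (open_content U <= open_content V)%E.
Proof.
move=> UV; apply: ge_ereal_sup => _ [f fU <-].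
by apply: open_content_ub; exact: subordinateS fU.
Qed.

Lemma open_content_le U : (open_content U <= `|M|%:E)%E.
Proof.
apply: ge_ereal_sup => _ [f [f01 _] <-]; rewrite lee_fin.
rewrite (le_trans (ler_norm _))// (le_trans (LM f))// (@le_trans _ _ (`|M| * `|f|))//.
  by rewrite ler_wpM2r// ler_norm.
rewrite ler_piMr// C0_normr_le// => x; have /andP[f0 f1] := f01 x.
by rewrite ger0_norm.
Qed.

Lemma open_content_fin U : open_content U \is a fin_num.
Proof.
by rewrite ge0_fin_numE ?open_content_ge0// (le_lt_trans (open_content_le U))// ltry.
Qed.

Lemma open_content0 : open_content set0 = 0%E.
Proof.
apply/eqP; rewrite eq_le open_content_ge0 andbT.
apply: ge_ereal_sup => _ [f [_ f0] <-]; rewrite (_ : f = 0) ?functional0//.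
by apply: C0_ext => x; exact: f0.
Qed.

(** The errors in this part are multiples of |M|, which may vanish; dividing by
    |M| + 1 keeps them under control. *)
Lemma divM_le (e : R) : 0 < e -> e / (`|M| + 1) * `|M| <= e.
Proof.
move=> e0; rewrite -mulrA ler_piMr ?(ltW e0)// mulrC ler_pdivrMr ?ltr_wpDl//.
by rewrite mul1r lerDl.
Qed.

(** The function (f - e)^+ is supported in a superlevel set of f, and the
    functional hardly distinguishes it from f.  It replaces the compactly
    supported functions of the usual proofs. *)
Lemma cut_off f (e : R) : 0 < e -> (forall x, 0 <= f x) -> exists h,
  (forall x, h x = f x - Num.min (f x) e) /\ L f - e * `|M| <= L h.
Proof.
move=> e0 f0; have [k kE] : exists k : C0 R X, forall x, k x = Num.min (f x) e.
  by apply: (C0_min_exists (u := fun=> e)) => // x; [exact: cvg_cst|rewrite ltW].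
exists (f - k); split=> [x|]; first by change (f x - k x = f x - Num.min (f x) e); rewrite kE.
rewrite functionalB lerD2l lerN2 (le_trans (ler_norm _))// (le_trans (LM k))//.
rewrite (@le_trans _ _ (`|M| * `|k|))//.
  by rewrite ler_wpM2r// ler_norm.
rewrite mulrC ler_wpM2r// C0_normr_le ?ltW// => x.
by rewrite kE ger0_norm ?ge_min ?lexx ?orbT// le_min f0 ltW.
Qed.

(** The superadditivity behind both the measurability of the open sets and the
    tightness of the measure: if g lives off the superlevel set {e <= f}, then
    (f - e)^+ + g is still bounded by 1. *)
Lemma open_content_split V f (e : R) : 0 < e -> subordinate f V ->
  ((L f - e * `|M|)%:E + open_content (V `\` [set x | (e <= f x)%R]) <= open_content V)%E.
Proof.
move=> e0 [f01 fV]; have f0 x : 0 <= f x by have /andP[] := f01 x.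
have [h [hE Lh]] := cut_off e0 f0.
rewrite addeC -leeBrDr//; apply: ge_ereal_sup => _ [g [g01 gV] <-].
rewrite leeBrDr// -EFinD; apply: (@le_trans _ _ (L (g + h))%:E).
  by rewrite lee_fin LD lerD2l.
apply: open_content_ub; split=> x; change ((g + h) x) with (g x + h x); rewrite hE.
  have /andP[g0 g1] := g01 x; have /andP[_ f1] := f01 x.
  have [ef|fe] := leP e (f x).
    rewrite gV; last by move=> [_]; apply.
    lra.
  by rewrite subrr addr0; exact: g01.
move=> Vx; rewrite fV// gV; last by move=> [].
by rewrite min_l ?ltW// subrr addr0.
Qed.

Lemma riesz_outer_open U : open U -> riesz_outer U = open_content U.
Proof.
move=> oU; apply/eqP; rewrite eq_le; apply/andP; split.
  by apply: ereal_inf_lbound; exists U => //; split.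
by apply: le_ereal_inf_tmp => _ [V [oV UV] <-]; exact: le_open_content.
Qed.

Lemma riesz_outer_ge0 A : (0 <= riesz_outer A)%E.
Proof. by apply: le_ereal_inf_tmp => _ [V _ <-]; exact: open_content_ge0. Qed.

Lemma le_riesz_outer A B : A `<=` B -> (riesz_outer A <= riesz_outer B)%E.
Proof.
move=> AB; apply: le_ereal_inf_tmp => _ [V [oV BV] <-].
by apply: ereal_inf_lbound; exists V => //; split=> //; exact: subset_trans BV.
Qed.

Lemma riesz_outer_fin A : riesz_outer A \is a fin_num.
Proof.
rewrite ge0_fin_numE ?riesz_outer_ge0//.
apply: le_lt_trans (ltry `|M|); apply: le_trans (open_content_le setT).
by apply: ereal_inf_lbound; exists setT => //; split=> //; exact: openT.
Qed.

Lemma riesz_outer_adherent A (e : R) : 0 < e ->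
  exists U, [/\ open U, A `<=` U & (open_content U < riesz_outer A + e%:E)%E].
Proof.
move=> e0; have [_ [U [oU AU] <-] UA] := lb_ereal_inf_adherent e0 (riesz_outer_fin A).
by exists U.
Qed.

(** Let f be supported in the union of the U_i, let u_i be positive exactly on
    U_i.  On the compact set {d <= f} the sums of the functions N u_i, for i < N,
    exceed 1 for N large, so up to d the function f lies below the sum of the
    functions min(f, N u_i), each of which is supported in one U_i. *)
Lemma open_content_sigma_subadditive (U : nat -> set X) : (forall i, open (U i)) ->
  (open_content (\bigcup_i U i) <= \sum_(i <oo) open_content (U i))%E.
Proof.
move=> oU; apply: ge_ereal_sup => _ [f [f01 fU] <-].
have f0 x : 0 <= f x by have /andP[] := f01 x.
apply/lee_addgt0Pr => e e0.
have M1 : 0 < `|M| + 1 by rewrite ltr_wpDl.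
pose d := e / (`|M| + 1); have d0 : 0 < d by rewrite divr_gt0.
have [h [hE Lh]] := cut_off d0 f0.
have [u uP] := choice (fun i => open_cozero (oU i)).
have u0 i x : 0 <= u i x by have [] := uP i.
pose w n x := \sum_(i < n) n%:R * u i x.
have cw n : continuous (w n).
  move=> x; apply: cvg_big => [|i _]; first exact: add_continuous.
  by apply: cvgM; [exact: cvg_cst|have [cu _ _ _] := uP i; exact: cu].
have ndw x m n : (m <= n)%N -> w m x <= w n x.
  have wE k : w k x = \sum_(0 <= i < k) k%:R * u i x by rewrite big_mkord.
  move=> mn; rewrite !wE (@big_cat_nat _ _ _ m 0%N n)//= -[leLHS]addr0 lerD//.
    by apply: ler_sum => i _; rewrite ler_wpM2r// ler_nat.
  by apply: sumr_ge0 => i _; rewrite mulr_ge0.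
have [_ /(_ _ d0) cK] := C0P f.
(* One integer serves as the number of terms and as the factor, which makes the
   sums w n increase with n. *)
have [N KN] : exists N, [set x | d <= `|f x|] `<=` [set x | 1 < w N x].
  apply: (compact_cover_seq (O := fun n => [set x | 1 < w n x])) cK _ _ _.
  - by move=> n; exact: open_superlevel.
  - by move=> m n mn x /= /lt_le_trans; apply; exact: ndw.
  - move=> x /= dfx; have [i _ Uix] : (\bigcup_i U i) x.
      by apply: contrapT => /fU fx; move: dfx; rewrite fx normr0 leNgt d0.
    have uix : 0 < u i x by have [_ _ _] := uP i; apply.
    exists (maxn i (Num.truncn (u i x)^-1)).+1 => //=.
    rewrite /w (bigD1 (Ordinal (leq_maxl i (Num.truncn (u i x)^-1) : (_ < _.+1)%N)))//=.
    apply: ltr_wpDr; first by apply: sumr_ge0 => k _; rewrite mulr_ge0.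
    rewrite -ltr_pdivrMr// mul1r (lt_le_trans (truncnS_gt _))// ler_nat.
    by rewrite ltnS leq_maxr.
have kP i : exists k : C0 R X, forall x, k x = Num.min (f x) (N%:R * u i x).
  apply: (C0_min_exists (u := fun x => N%:R * u i x)) => // x; last by rewrite mulr_ge0.
  by apply: cvgM; [exact: cvg_cst|have [cu _ _ _] := uP i; exact: cu].
have [k kE] := choice kP.
have k0 i x : 0 <= k i x by rewrite kE le_min f0 mulr_ge0.
have hk x : h x <= (\sum_(i < N) k i) x.
  rewrite hE C0_sumE; have [fd|df] := leP (f x) d.
    by rewrite subrr sumr_ge0.
  have wN : 1 < w N x by apply: KN; rewrite /= ger0_norm// ltW.
  apply: (@le_trans _ _ (f x)); first by rewrite gerBl ltW.
  have [[i fi]|/forallNP H] := pselect (exists i : 'I_N, f x <= N%:R * u i x).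
    by rewrite (bigD1 i)//= kE min_l// lerDl sumr_ge0.
  rewrite (eq_bigr (fun i : 'I_N => N%:R * u i x)) => [|i _].
    by have /andP[_ /le_trans->//] := f01 x; exact: ltW.
  by rewrite kE min_r// leNgt; apply/negP => /ltW /H.
apply: (@le_trans _ _ (L h + e)%:E).
  by rewrite lee_fin -lerBlDr (le_trans _ Lh)// lerB// divM_le.
rewrite EFinD leeD2r//; apply: (@le_trans _ _ (\sum_(i < N) (L (k i))%:E)%E).
  by rewrite sumEFin lee_fin -functional_sum; exact: le_functional.
apply: (@le_trans _ _ (\sum_(i < N) open_content (U i))%E).
  apply: lee_sum => i _; apply: open_content_ub; split=> x.
    rewrite k0 kE ge_min; have /andP[_ ->] := f01 x; by [].
  by move=> nU; rewrite kE; have [_ _ uF _] := uP i; rewrite uF// mulr0 min_r.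
rewrite -(big_mkord xpredT (fun i => open_content (U i))).
by apply: nneseries_lim_ge => i _ _; exact: open_content_ge0.
Qed.

Lemma riesz_outer_sigma_subadditive : sigma_subadditive riesz_outer.
Proof.
move=> A; apply/lee_addgt0Pr => e e0.
have e2 n : 0 < e / 2 ^+ n.+1 by rewrite divr_gt0// exprn_gt0.
have [U UP] := choice (fun n => riesz_outer_adherent (A n) (e2 n)).
apply: (@le_trans _ _ (open_content (\bigcup_n U n))).
  rewrite -riesz_outer_open; last by apply: bigcup_open => n _; have [] := UP n.
  by apply: le_riesz_outer; apply: subset_bigcup => n _; have [] := UP n.
apply: le_trans (open_content_sigma_subadditive _) _.
  by move=> n; have [] := UP n.
apply: le_trans (epsilon_trick xpredT _ (ltW e0)); last by move=> n; exact: riesz_outer_ge0.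
apply: lee_nneseries => [n _ _|n _]; first exact: open_content_ge0.
by have [_ _ /ltW] := UP n; rewrite natrX.
Qed.

Lemma riesz_outer0 : riesz_outer set0 = 0%E.
Proof. by rewrite riesz_outer_open ?open_content0//; exact: open0. Qed.

Let mu : {outer_measure set X -> \bar R} := HB.pack riesz_outer
  (isOuterMeasure.Build R X riesz_outer riesz_outer0 riesz_outer_ge0
    le_riesz_outer riesz_outer_sigma_subadditive).

(** It is enough to cut an open set V with U.  If f is almost optimal for the
    intersection of U and V, then the part of V outside U avoids every
    superlevel set of f, and [open_content_split] applies. *)
Lemma riesz_outer_caratheodory_open U : open U -> mu.-caratheodory U.
Proof.
move=> oU; apply: le_caratheodory_measurable => A.
apply: le_ereal_inf_tmp => _ [V [oV AV] <-].
apply/lee_addgt0Pr => e e0.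
have M1 : 0 < `|M| + 1 by rewrite ltr_wpDl.
rewrite (@le_trans _ _ (riesz_outer (V `&` U) + riesz_outer (V `\` U))%E)//.
  by apply: leeD; apply: le_riesz_outer; [exact: setSI|exact: setSI].
rewrite riesz_outer_open; last exact: openI.
rewrite -leeBrDr ?riesz_outer_fin//; apply: ge_ereal_sup => _ [f [f01 fVU] <-].
pose d := e / (`|M| + 1); have d0 : 0 < d by rewrite divr_gt0.
have fV : subordinate f V by split=> // x nV; apply: fVU => -[].
pose W := V `\` [set x | d <= f x].
have VW : ((L f - d * `|M|)%:E + open_content W <= open_content V)%E.
  exact: open_content_split.
have oW : open W.
  rewrite /W setDE; apply: openI => //.
  exact/open_not_superlevel/C0_continuous.
rewrite leeBrDr ?riesz_outer_fin//.
apply: (@le_trans _ _ ((L f)%:E + open_content W)%E).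
  rewrite leeD2l// -riesz_outer_open//; apply: le_riesz_outer => x [Vx nUx].
  by split=> //= dfx; move: dfx; rewrite fVU ?leNgt ?d0// => -[].
move: VW; rewrite -(fineK (open_content_fin W)) -(fineK (open_content_fin V)) -!EFinD !lee_fin.
have := divM_le e0; rewrite -/d; lra.
Qed.

Lemma borel_caratheodory (A : set (borel X)) : measurable A -> mu.-caratheodory A.
Proof.
apply: (@smallest_sub _ (sigma_algebra setT) (@open X) mu.-caratheodory).
  split; first exact: caratheodory_measurable_set0.
  - by move=> B mB; rewrite setTD; exact: caratheodory_measurable_setC.
  - by move=> F mF; exact: caratheodory_measurable_bigcup.
exact: riesz_outer_caratheodory_open.
Qed.

Definition riesz_fun (A : set (borel X)) : R :=
  if `[< measurable A >] then fine (riesz_outer A) else 0.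

Lemma riesz_funE (A : set (borel X)) : measurable A ->
  (riesz_fun A)%:E = riesz_outer A.
Proof. by move=> mA; rewrite /riesz_fun asboolT// fineK// riesz_outer_fin. Qed.

Lemma riesz_fun_ge0 A : 0 <= riesz_fun A.
Proof.
by rewrite /riesz_fun; case: ifP => // _; rewrite fine_ge0// riesz_outer_ge0.
Qed.

Lemma riesz_fun_sigma_additive : semi_sigma_additive (fun A => (riesz_fun A)%:E).
Proof.
move=> F mF tF mUF; rewrite riesz_funE//.
under eq_fun do under eq_bigr do rewrite riesz_funE//.
apply: (@caratheodory_measure_sigma_additive R X mu F) => // [i|].
  exact: borel_caratheodory.
exact: borel_caratheodory.
Qed.

(** Finite additivity turns the outer approximation of A into a bound for the
    measure of the excess. *)
Lemma riesz_outerC_small (A V : set X) : open V -> measurable (A : set (borel X)) ->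
  forall e : R, (open_content V < riesz_outer A + e%:E)%E -> A `<=` V ->
  (riesz_outer (V `\` A) <= e%:E)%E.
Proof.
move=> oV mA e Ve AV; have := borel_caratheodory mA V.
rewrite (_ : mu V = open_content V); last exact: riesz_outer_open.
rewrite (setIidr AV) => VE; move: Ve; rewrite VE setDE.
rewrite -[mu A]/(riesz_outer A) -[mu (_ `&` _)]/(riesz_outer _).
by rewrite lteD2lE ?riesz_outer_fin// => /ltW.
Qed.

(** The superlevel sets of an almost optimal function for the whole space are
    compact and carry almost all the mass. *)
Lemma riesz_tight (e : R) : 0 < e -> exists2 K : set X, compact K &
  open (~` K) /\ (riesz_outer (~` K) <= e%:E)%E.
Proof.
move=> e0; have e20 : 0 < e / 2 by rewrite divr_gt0.
have M1 : 0 < `|M| + 1 by rewrite ltr_wpDl.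
pose d := e / 2 / (`|M| + 1); have d0 : 0 < d by rewrite divr_gt0.
have [_ [f fT <-] fe] := ub_ereal_sup_adherent e20 (open_content_fin setT).
have f0 x : 0 <= f x by have [/(_ x)/andP[]] := fT.
have oW : open (~` [set x | d <= f x]) by exact/open_not_superlevel/C0_continuous.
exists [set x | d <= f x].
  have [_ /(_ _ d0)] := C0P f; congr compact; apply/funext => x /=.
  by rewrite ger0_norm.
split=> //; rewrite riesz_outer_open//.
have := open_content_split d0 fT; rewrite setTD; set W := ~` _.
move: fe; rewrite -/(open_content _).
rewrite -(fineK (open_content_fin W)) -(fineK (open_content_fin setT)).
rewrite -EFinB -!EFinD !lee_fin lte_fin.
have := divM_le e20; rewrite -/d; lra.
Qed.

(** Approximate A and its complement from outside by U and V, and intersect the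
    complement of V with a compact set carrying almost all the mass. *)
Lemma riesz_fun_regular : regular_set_function riesz_fun.
Proof.
move=> A e mA e0; have e40 : 0 < e / 4 by rewrite divr_gt0.
have [U [oU AU Ue]] := riesz_outer_adherent A e40.
have [V [oV AV Ve]] := riesz_outer_adherent (~` A) e40.
have [K cK [oK Ke]] := riesz_tight e40.
(* U minus the compact set lies in (U - A), (V - A^c) and the complement of K,
   each of measure at most e / 4. *)
exists (~` V `&` K), U; split=> //.
- by rewrite setIC; apply: compact_closedI => //; exact: open_closedC.
- by move=> x [nVx _]; apply: contrapT => /AV.
move=> B mB BUK; rewrite ger0_norm ?riesz_fun_ge0// -lte_fin riesz_funE//.
apply: (@le_lt_trans _ _ (riesz_outer (((U `\` A) `|` (V `\` ~` A)) `|` ~` K))).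
  apply: le_riesz_outer => x /BUK[Ux /not_andP[/contrapT Vx|Kx]]; last by right.
  by left; have [Ax|nAx] := pselect (A x); [right; split=> //; exact|left].
apply: (@le_lt_trans _ _ ((e / 4)%:E + (e / 4)%:E + (e / 4)%:E)%E).
  apply: (le_trans (outer_measureU2 mu _ _)); apply: leeD => //.
  apply: (le_trans (outer_measureU2 mu _ _)); apply: leeD.
    exact: riesz_outerC_small.
  by apply: riesz_outerC_small => //; exact: measurableC.
by rewrite -!EFinD lte_fin; lra.
Qed.

Lemma riesz_fun_subproof : riesz_fun \in @signed_measure_pred R X.
Proof.
apply/asboolP; split.
- by move=> A mA; rewrite /riesz_fun asboolF.
- by apply: EFin_inj; rewrite riesz_funE// riesz_outer0.
- exact: riesz_fun_sigma_additive.
- exact: riesz_fun_regular.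
Qed.

Definition riesz_measure : signed_measure X := MkSignedMeasure riesz_fun_subproof.

Lemma riesz_measure_open U : open U -> (riesz_measure U)%:E = open_content U.
Proof.
by move=> oU; rewrite riesz_funE ?riesz_outer_open//; exact: borel_open.
Qed.

End Riesz_outer_measure.

(** * Integration against signed measures *)

Section finite_measures.
Context {R : realType} {X : pmetricType R}.
Notation borelX := (borel X).
Implicit Types (f : X -> R) (m : {measure set borelX -> \bar R}).

Definition bounded_measurable f :=
  measurable_fun [set: borelX] (f : borelX -> R) /\ exists C, forall x, `|f x| <= C.

Lemma borel_continuous_real f : continuous f ->
  measurable_fun [set: borelX] (f : borelX -> R).
Proof.
move=> /continuousP cf; apply: (measurability _ (RGenOpens.measurableE R)).
move=> _ [_ [a [b ->]] <-]; rewrite setTI.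
by apply: borel_open; apply: cf; exact: interval_open.
Qed.

Lemma C0_bounded_measurable (f : C0 R X) : bounded_measurable f.
Proof.
split; first by apply: borel_continuous_real; exact: C0_continuous.
by exists `|f| => x; exact: C0_le_norm.
Qed.

Lemma bounded_measurable_integrable m f : (m setT < +oo)%E ->
  bounded_measurable f -> m.-integrable setT (EFin \o f).
Proof.
move=> mT [mf [C fC]]; apply: measurable_bounded_integrable => //.
by exists C; split; [exact: num_real|move=> c Cc x _; exact: le_trans (ltW Cc)].
Qed.

(** The bundled type keeps the sum recognizable as a measure after rewriting;
    the same is done for multiples. *)
Definition measure_sum m1 m2 : {measure set borelX -> \bar R} := measure_add m1 m2.

Lemma measure_sumE m1 m2 A : measure_sum m1 m2 A = (m1 A + m2 A)%E.
Proof. exact: measure_addE. Qed.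

Definition measure_scaling (c : {nonneg R}) m : {measure set borelX -> \bar R} := mscale c m.

Lemma measure_scalingE (c : {nonneg R}) m A : measure_scaling c m A = (c%:num%:E * m A)%E.
Proof. by []. Qed.

Lemma Rintegral_measure_add m1 m2 f : (m1 setT < +oo)%E -> (m2 setT < +oo)%E ->
  bounded_measurable f -> Rintegral (measure_sum m1 m2) setT f =
  Rintegral m1 setT f + Rintegral m2 setT f.
Proof.
move=> fm1 fm2 bf; rewrite /Rintegral /measure_sum integral_measure_add//.
- by rewrite fineD//; apply: integrable_fin_num => //; exact: bounded_measurable_integrable.
- exact: bounded_measurable_integrable.
- exact: bounded_measurable_integrable.
Qed.

Lemma eq_Rintegral_measure m1 m2 f :
  (forall A, measurable A -> m1 A = m2 A) ->
  Rintegral m1 setT f = Rintegral m2 setT f.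
Proof.
by move=> m12; rewrite /Rintegral (eq_measure_integral m2)// => A mA _; exact: m12.
Qed.

Section jordan.
Variable nu : signed_measure X.

Definition pos_part : {measure set borelX -> \bar R} := jordan_pos (svalP (hahn_ex nu)).
Definition neg_part : {measure set borelX -> \bar R} := jordan_neg (svalP (hahn_ex nu)).

Lemma pos_part_fin : (pos_part setT < +oo)%E.
Proof. by rewrite /pos_part -ge0_fin_numE// fin_num_measure. Qed.

Lemma neg_part_fin : (neg_part setT < +oo)%E.
Proof. by rewrite /neg_part -ge0_fin_numE// fin_num_measure. Qed.

Lemma signed_measure_jordan A : measurable A -> ((nu A)%:E = pos_part A - neg_part A)%E.
Proof.
move=> mA; rewrite -[LHS]/(charge_of nu A) (jordan_decomp (svalP (hahn_ex nu)) mA).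
by rewrite /cadd /= cscaleN1.
Qed.

Lemma integral_signed_jordan f :
  integral_signed f nu = Rintegral pos_part setT f - Rintegral neg_part setT f.
Proof. by []. Qed.

End jordan.

Lemma measure_le_fin m A : (m setT < +oo)%E -> measurable A -> m A \is a fin_num.
Proof.
move=> mT mA; rewrite ge0_fin_numE//; apply: le_lt_trans mT.
by apply: le_measure => //; rewrite inE.
Qed.

(** The integral of a signed measure is defined through one chosen Jordan
    decomposition, but every way of writing nu as a difference m1 - m2 of finite
    measures computes it: nu^+ + m2 and m1 + nu^- are the same measure.  The
    linearity in nu and the formula for push-forwards follow from this. *)
Lemma integral_signedE (nu : signed_measure X) m1 m2 f :
  (m1 setT < +oo)%E -> (m2 setT < +oo)%E ->
  (forall A : set borelX, measurable A -> ((nu A)%:E = m1 A - m2 A)%E) ->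
  bounded_measurable f ->
  integral_signed f nu = Rintegral m1 setT f - Rintegral m2 setT f.
Proof.
move=> fm1 fm2 nuE bf; rewrite /integral_signed.
have fp := pos_part_fin nu; have fn := neg_part_fin nu.
suff : Rintegral (measure_sum (pos_part nu) m2) setT f =
    Rintegral (measure_sum m1 (neg_part nu)) setT f.
  by rewrite !Rintegral_measure_add// -/(pos_part nu) -/(neg_part nu); lra.
apply: eq_Rintegral_measure => A mA; rewrite !measure_sumE.
have := nuE A mA; rewrite signed_measure_jordan//.
rewrite -(fineK (measure_le_fin fm1 mA)) -(fineK (measure_le_fin fm2 mA)).
rewrite -(fineK (measure_le_fin fp mA)) -(fineK (measure_le_fin fn mA)).
by rewrite -!EFinB -!EFinD => -[] H; congr EFin; lra.
Qed.

Lemma integral_signedD nu mu f : bounded_measurable f ->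
  integral_signed f (nu + mu) = integral_signed f nu + integral_signed f mu.
Proof.
move=> bf.
rewrite (@integral_signedE _ (measure_sum (pos_part nu) (pos_part mu))
  (measure_sum (neg_part nu) (neg_part mu)))//.
- by rewrite !Rintegral_measure_add ?pos_part_fin ?neg_part_fin// !integral_signed_jordan; lra.
- by rewrite measure_sumE lte_add_pinfty// pos_part_fin.
- by rewrite measure_sumE lte_add_pinfty// neg_part_fin.
- move=> A mA; rewrite !measure_sumE; change ((nu + mu) A) with (nu A + mu A).
  rewrite EFinD !signed_measure_jordan//.
  rewrite -(fineK (measure_le_fin (pos_part_fin nu) mA)).
  rewrite -(fineK (measure_le_fin (pos_part_fin mu) mA)).
  rewrite -(fineK (measure_le_fin (neg_part_fin nu) mA)).
  rewrite -(fineK (measure_le_fin (neg_part_fin mu) mA)).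
  by rewrite -!EFinB -!EFinD; congr EFin; lra.
Qed.

Lemma integral_signed0 f : bounded_measurable f -> integral_signed f 0 = 0.
Proof.
move=> bf; rewrite (@integral_signedE _ mzero mzero) ?subrr//; do ?exact: (ltry 0).
by move=> A mA; rewrite sube0.
Qed.

Lemma integral_signedN nu f : bounded_measurable f ->
  integral_signed f (- nu) = - integral_signed f nu.
Proof.
move=> bf; apply/eqP; rewrite -subr_eq0 opprK -integral_signedD// addNr.
by rewrite integral_signed0.
Qed.

Lemma integral_signedZ (a : R) nu f : bounded_measurable f ->
  integral_signed f (a *: nu) = a * integral_signed f nu.
Proof.
move=> bf; wlog a0 : a / 0 <= a => [H|].
  have [|/ltW a0] := leP 0 a; first exact: H.
  rewrite -[a]opprK scaleNr integral_signedN// H ?oppr_ge0//.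
  by rewrite !mulNr.
pose c := NngNum a0.
rewrite (@integral_signedE _ (measure_scaling c (pos_part nu)) (measure_scaling c (neg_part nu)))//.
- rewrite integral_signed_jordan mulrBr.
  have Z m : (m setT < +oo)%E -> Rintegral (measure_scaling c m) setT f = a * Rintegral m setT f.
    move=> mT; have intf := bounded_measurable_integrable mT bf.
    have mf := measurable_int _ intf.
    rewrite /Rintegral /measure_scaling -[a in RHS]/(fine a%:E) -fineM//; last first.
      exact: integrable_fin_num.
    congr fine; rewrite integralE [in RHS]integralE !ge0_integral_mscale//.
    - rewrite -(fineK (integrable_pos_fin_num measurableT intf)).
      rewrite -(fineK (integrable_neg_fin_num measurableT intf)).
      by rewrite -!EFinM -!EFinB; congr EFin; rewrite mulrBr.

    - exact: measurable_funeneg.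
    - exact: measurable_funepos.
  by rewrite !Z ?pos_part_fin ?neg_part_fin.
- by rewrite measure_scalingE lte_mul_pinfty// pos_part_fin.
- by rewrite measure_scalingE lte_mul_pinfty// neg_part_fin.
- move=> A mA; change ((a *: nu) A) with (a * nu A); rewrite EFinM signed_measure_jordan//.
  rewrite !measure_scalingE -(fineK (measure_le_fin (pos_part_fin nu) mA)).
  rewrite -(fineK (measure_le_fin (neg_part_fin nu) mA)).
  exact: (congr1 EFin (mulrBr a _ _)).
Qed.

End finite_measures.

Section integral_properties.
Context {R : realType} {X : pmetricType R}.
Notation borelX := (borel X).
Implicit Types (f g : C0 R X) (nu mu : signed_measure X).

Lemma integral_signed_addl nu f g :
  integral_signed (f + g) nu = integral_signed f nu + integral_signed g nu.
Proof.
rewrite !integral_signed_jordan.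
have D (m : {measure set borelX -> \bar R}) : (m setT < +oo)%E ->
  Rintegral m setT (f + g) = Rintegral m setT f + Rintegral m setT g.
  by move=> mT; rewrite -RintegralD//; apply: bounded_measurable_integrable => //;
    exact: C0_bounded_measurable.
by rewrite !D ?pos_part_fin ?neg_part_fin//; lra.
Qed.

Lemma integral_signed_scalel nu (c : R) f :
  integral_signed (c *: f) nu = c * integral_signed f nu.
Proof.
rewrite !integral_signed_jordan.
have D (m : {measure set borelX -> \bar R}) : (m setT < +oo)%E ->
  Rintegral m setT (c *: f) = c * Rintegral m setT f.
  by move=> mT; rewrite -RintegralZl//; apply: bounded_measurable_integrable => //;
    exact: C0_bounded_measurable.
by rewrite !D ?pos_part_fin ?neg_part_fin// mulrBr.
Qed.

Section nonneg.
Variables (nu : signed_measure X) (nu0 : nonnegative nu).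

Let cnu0 A : (0 <= charge_of nu A)%E.
Proof. by rewrite lee_fin. Qed.

Definition measure_of_nonneg : {measure set borelX -> \bar R} := measure_of_charge _ cnu0.

Lemma measure_of_nonnegE A : measure_of_nonneg A = (nu A)%:E.
Proof. by []. Qed.

Lemma integral_signed_nonneg (f : X -> R) : bounded_measurable f ->
  integral_signed f nu = Rintegral measure_of_nonneg setT f.
Proof.
move=> bf; rewrite (@integral_signedE _ _ _ measure_of_nonneg mzero) ?ltry//; last first.
  by move=> A _; rewrite sube0.
by rewrite [X in _ - X](_ : _ = 0) ?subr0// /Rintegral integral_measure_zero.
Qed.

Lemma le_integral_signed (f g : X -> R) : bounded_measurable f -> bounded_measurable g ->
  (forall x, f x <= g x) -> integral_signed f nu <= integral_signed g nu.
Proof.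
move=> bf bg fg; rewrite !integral_signed_nonneg//.
by apply: le_Rintegral => //; apply: bounded_measurable_integrable => //; exact: ltry.
Qed.

Lemma indic_bounded_measurable (A : set borelX) : measurable A ->
  bounded_measurable (\1_A : X -> R).
Proof.
move=> mA; split; first exact: measurable_indic.
by exists 1 => x; rewrite indicE; case: (_ \in _) => /=; rewrite ?normr1 ?normr0.
Qed.

Lemma integral_signed_indic (A : set borelX) : measurable A ->
  integral_signed (\1_A : X -> R) nu = nu A.
Proof.
move=> mA; rewrite integral_signed_nonneg//; last exact: indic_bounded_measurable.
by rewrite /Rintegral integral_indic// setIT measure_of_nonnegE.
Qed.

Lemma integral_signed_cst (c : R) : integral_signed (fun=> c) nu = c * nu setT.
Proof.
rewrite integral_signed_nonneg; last first.
  by split; [exact: measurable_cst|exists `|c|].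
by rewrite Rintegral_cst.
Qed.

End nonneg.

(** Every function is a difference of non-negative ones, and those can be scaled
    into [0, 1]. *)
Lemma eq_functional_unit_range (J1 J2 : C0 R X -> R) :
  (forall f g, J1 (f + g) = J1 f + J1 g) -> (forall (c : R) f, J1 (c *: f) = c * J1 f) ->
  (forall f g, J2 (f + g) = J2 f + J2 g) -> (forall (c : R) f, J2 (c *: f) = c * J2 f) ->
  (forall f, (forall x, 0 <= f x <= 1) -> J1 f = J2 f) -> forall f, J1 f = J2 f.
Proof.
move=> D1 Z1 D2 Z2 J12.
have pos f : (forall x, 0 <= f x) -> J1 f = J2 f.
  move=> f0; have c0 : 0 < `|f| + 1 by rewrite ltr_wpDl.
  have -> : f = (`|f| + 1) *: ((`|f| + 1)^-1 *: f).
    by rewrite scalerA mulfV ?gt_eqF// scale1r.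
  rewrite Z1 Z2 J12// => x; change (0 <= (`|f| + 1)^-1 * f x <= 1).
  rewrite mulr_ge0 ?invr_ge0 ?(ltW c0)//= mulrC ler_pdivrMr// mul1r.
  by rewrite -(ger0_norm (f0 x)) (le_trans (C0_le_norm f x))// lerDl.
move=> f; have vp : vanishing_continuous (fun x => Num.max (f x) 0).
  apply: (@vanishing_continuous_dominated _ _ _ f) => x.
    by apply: (@continuous_max R X f (fun=> 0)); [exact: C0_continuous|exact: cvg_cst].
  by rewrite ger0_norm ?le_max ?lexx ?orbT// ge_max normr_ge0 ler_norm.
have pg0 x : 0 <= mkC0 vp x by rewrite /= le_max lexx orbT.
have -> : f = mkC0 vp + (-1) *: (mkC0 vp - f).
  by rewrite scaleN1r opprB addrC subrK.
rewrite D1 D2 Z1 Z2 !pos// => x.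
by change (0 <= Num.max (f x) 0 - f x); rewrite subr_ge0 le_max lexx.
Qed.

(** The layers n (min(f, (i+1)/n) - min(f, i/n)) of f are functions with values
    in [0, 1] that are 1 on {f > (i+1)/n} and 0 off {f > i/n}, so that J is
    trapped on them between two values of [al]. *)
Lemma slicing_bounds (J : C0 R X -> R) (al : set X -> R) f n :
  (forall f g, J (f + g) = J f + J g) -> (forall (c : R) f, J (c *: f) = c * J f) ->
  (forall U g, open U -> subordinate g U -> J g <= al U) ->
  (forall U g, open U -> (forall x, 0 <= g x <= 1) -> (forall x, U x -> g x = 1) ->
    al U <= J g) ->
  (forall x, 0 <= f x <= 1) -> (0 < n)%N ->
  \sum_(i < n) al [set x | i.+1%:R / n%:R < f x] <= n%:R * J f <=
  \sum_(i < n) al [set x | i%:R / n%:R < f x].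
Proof.
move=> JD JZ J1 J2 f01 n0; have f0 x : 0 <= f x by have /andP[] := f01 x.
have n0R : 0 < n%:R :> R by rewrite ltr0n.
have J0 : J 0 = 0 by rewrite -[0](scale0r (0 : C0 R X)) JZ mul0r.
have hP (i : nat) : exists h : C0 R X, forall x, h x = Num.min (f x) (i%:R / n%:R).
  by apply: (C0_min_exists (u := fun=> i%:R / n%:R)) => // x; exact: cvg_cst.
have [h hE] := choice hP.
pose k (i : nat) := n%:R *: (h i.+1 - h i).
have kE i x : k i x = n%:R * (Num.min (f x) (i.+1%:R / n%:R) - Num.min (f x) (i%:R / n%:R)).
  by rewrite -!hE.
have step i : i.+1%:R / n%:R = i%:R / n%:R + n%:R^-1 :> R.
  by rewrite -[i.+1]addn1 natrD mulrDl mul1r.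
have nV : n%:R * n%:R^-1 = 1 :> R by rewrite mulfV// gt_eqF.
have nV0 : 0 < n%:R^-1 :> R by rewrite invr_gt0.
have kle i x : f x <= i%:R / n%:R -> k i x = 0.
  move=> fi; rewrite kE !min_l ?subrr ?mulr0// (le_trans fi)// step lerDl ltW//.
have kge i x : i.+1%:R / n%:R <= f x -> k i x = 1.
  move=> fi; rewrite kE min_r// min_r ?step; last first.
    by rewrite (le_trans _ fi)// step lerDl ltW.
  by rewrite addrAC subrr add0r.
have k01 i x : 0 <= k i x <= 1.
  have [/kle ->|fi] := leP (f x) (i%:R / n%:R); first by rewrite lexx ler01.
  have [/kge ->|fi1] := leP (i.+1%:R / n%:R) (f x); first by rewrite lexx ler01.
  rewrite kE min_l ?(ltW fi1)// min_r ?(ltW fi)//.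
  rewrite mulr_ge0 ?subr_ge0 ?(ltW fi)// ?(ltW n0R)//=.
  by rewrite -[leRHS]nV ler_wpM2l ?(ltW n0R)// lerBlDl -step ltW.
have -> : n%:R * J f = \sum_(i < n) J (k i).
  have -> : f = h n.
    by apply: C0_ext => x; rewrite hE mulfV ?gt_eqF// min_l//; have /andP[] := f01 x.
  rewrite -JZ -(big_morph J JD J0); congr J.
  rewrite -scaler_sumr; congr (_ *: _); rewrite -(big_mkord xpredT (fun i => h i.+1 - h i)).
  rewrite telescope_sumr//; suff -> : h 0%N = 0 by rewrite subr0.
  by apply: C0_ext => x; rewrite hE mul0r min_r.
have oU c : open [set x | c < f x] by apply/open_superlevel/C0_continuous.
apply/andP; split; apply: ler_sum => i _.
  by apply: J2 => // x /ltW; exact: kge.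
apply: J1 => //; split=> // x /negP; rewrite -leNgt; exact: kle.
Qed.

(** The two bounds of [slicing_bounds] telescope: they differ by at most M,
    whatever n is, so n |J1 f - J2 f| <= M for all n. *)
Lemma eq_functional_open (J1 J2 : C0 R X -> R) (al : set X -> R) (M : R) :
  (forall f g, J1 (f + g) = J1 f + J1 g) -> (forall (c : R) f, J1 (c *: f) = c * J1 f) ->
  (forall f g, J2 (f + g) = J2 f + J2 g) -> (forall (c : R) f, J2 (c *: f) = c * J2 f) ->
  (forall U g, open U -> subordinate g U -> J1 g <= al U) ->
  (forall U g, open U -> (forall x, 0 <= g x <= 1) -> (forall x, U x -> g x = 1) ->
    al U <= J1 g) ->
  (forall U g, open U -> subordinate g U -> J2 g <= al U) ->
  (forall U g, open U -> (forall x, 0 <= g x <= 1) -> (forall x, U x -> g x = 1) ->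
    al U <= J2 g) ->
  (forall U, open U -> 0 <= al U <= M) -> forall f, J1 f = J2 f.
Proof.
move=> D1 Z1 D2 Z2 U1 L1 U2 L2 alM; apply: eq_functional_unit_range => // f f01.
have M0 : 0 <= M by have /andP[] := alM _ (@openT X); exact: le_trans.
suff H (n : nat) : n.+1%:R * `|J1 f - J2 f| <= M.
  apply/eqP; rewrite -subr_eq0 -normr_eq0; apply: contraT => J12.
  have d0 : 0 < `|J1 f - J2 f| by rewrite lt_def J12 normr_ge0.
  have := H (Num.truncn (M / `|J1 f - J2 f|)).
  by rewrite leNgt -ltr_pdivrMr// truncnS_gt.
have /andP[l1 u1] := slicing_bounds D1 Z1 U1 L1 f01 (ltn0Sn n).
have /andP[l2 u2] := slicing_bounds D2 Z2 U2 L2 f01 (ltn0Sn n).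
set a := \sum_(i < _) _ in l1 l2; set b := \sum_(i < _) _ in u1 u2.
have ab : b - a <= M.
  rewrite /a /b big_ord_recl big_ord_recr /= opprD addrACA.
  rewrite [X in X <= _](_ : _ = al [set x | 0 / n.+1%:R < f x] -
    al [set x | n.+1%:R / n.+1%:R < f x]); last by rewrite -addrA addrC; lra.
  have oU c : open [set x | c < f x] by apply/open_superlevel/C0_continuous.
  have /andP[_ h1] := alM _ (oU (0 / n.+1%:R)).
  have /andP[h2 _] := alM _ (oU (n.+1%:R / n.+1%:R)).
  lra.
rewrite -[n.+1%:R]ger0_norm// -normrM ler_norml mulrBr; apply/andP; split; lra.
Qed.

End integral_properties.

(** * Riesz representation and its consequences *)

Section representation.
Context {R : realType} {X : pmetricType R}.
Notation borelX := (borel X).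
Implicit Types (f g : C0 R X) (nu mu : signed_measure X).

(** The functional and the integral against its measure satisfy the same bounds
    in terms of the content of open sets, hence agree by [eq_functional_open].
    The second clause bounds the mass of an open set, which is how supports and
    total masses are found later. *)
Theorem riesz_representation (L : C0 R X -> R) (M : R) :
  (forall f g, L (f + g) = L f + L g) -> (forall (c : R) f, L (c *: f) = c * L f) ->
  (forall f, (forall x, 0 <= f x) -> 0 <= L f) ->
  (forall f, `|L f| <= M * `|f|) ->
  exists nu, [/\ nonnegative nu,
    forall U c, open U -> (forall f, subordinate f U -> L f <= c) -> nu U <= c &
    forall f, integral_signed f nu = L f].
Proof.
move=> LD LZ L_ge0 LM; pose nu := riesz_measure LD LZ L_ge0 LM.
have nuU U : open U -> (nu U)%:E = open_content L U.
  exact: riesz_measure_open.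
have nu0 : nonnegative nu by move=> A; exact: riesz_fun_ge0.
exists nu; split=> // [U c oU Lc|].
  by rewrite -lee_fin nuU//; apply: ge_ereal_sup => _ [f fU <-]; rewrite lee_fin Lc.
have mU (U : set X) : open U -> measurable (U : set borelX) by exact: borel_open.
have bm f := C0_bounded_measurable f.
apply: (@eq_functional_open _ _ _ _ nu `|M|) => //.
- by move=> f g; exact: integral_signed_addl.
- by move=> c f; exact: integral_signed_scalel.
- move=> U g oU [g01 gU]; rewrite -(integral_signed_indic nu0 (mU _ oU)).
  apply: (le_integral_signed nu0 (bm g) (indic_bounded_measurable (mU _ oU))).
  move=> x; rewrite indicE; case: (boolP (x \in U)) => [_|].
    by have /andP[] := g01 x.
  by rewrite notin_setE => /gU ->.
- move=> U g oU g01 gU; rewrite -(integral_signed_indic nu0 (mU _ oU)).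
  apply: (le_integral_signed nu0 (indic_bounded_measurable (mU _ oU)) (bm g)).
  move=> x; rewrite indicE; case: (boolP (x \in U)) => [|_].
    by rewrite inE => /gU ->.
  by have /andP[] := g01 x.
- move=> U g oU gU; rewrite -lee_fin nuU//; exact: open_content_ub.
- move=> U g oU g01 gU; rewrite -lee_fin nuU//; apply: ge_ereal_sup => _ [f [f01 fU] <-].
  rewrite lee_fin; apply: (le_functional LD LZ L_ge0) => x.
  have [/gU ->|/fU ->] := pselect (U x); first by have /andP[] := f01 x.
  by have /andP[] := g01 x.
- by move=> U oU; rewrite nu0 -lee_fin nuU//; exact: open_content_le.
Qed.

Lemma integral_signed_dominated nu (g_ : nat -> X -> R) (g : X -> R) (C : R) :
  (forall n, bounded_measurable (g_ n)) -> bounded_measurable g ->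
  (forall n x, `|g_ n x| <= C) -> (forall x, g_ n x @[n --> \oo] --> g x) ->
  integral_signed (g_ n) nu @[n --> \oo] --> integral_signed g nu.
Proof.
move=> bg_ bg gC gg.
have D (m : {measure set borelX -> \bar R}) : (m setT < +oo)%E ->
  Rintegral m setT (g_ n) @[n --> \oo] --> Rintegral m setT g.
  move=> mT.
  have mg_ n := measurable_int _ (bounded_measurable_integrable mT (bg_ n)).
  have mg := measurable_int _ (bounded_measurable_integrable mT bg).
  have bC : bounded_measurable ((fun=> C) : X -> R).
    by split; [exact: measurable_cst|exists `|C|].
  have := @dominated_convergence _ _ _ m setT measurableT _ _ _ mg_ mg _
    (bounded_measurable_integrable mT bC).
  case.
  - by apply: aeW => x _; apply: cvg_EFin; [exact: nearW|exact: gg].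
  - by apply: aeW => x n _; rewrite lee_fin.
  move=> _ _ H; apply: fine_cvg; rewrite fineK//.
  apply: integrable_fin_num => //; exact: bounded_measurable_integrable.
by apply: cvgB; apply: D; [exact: pos_part_fin|exact: neg_part_fin].
Qed.

(** By regularity only compact sets K matter.  If g is 1 on K and u is the
    distance to K, the functions (g - n u)^+ decrease to the indicator of K. *)
Lemma integral_signed_eq0 nu : locally_compact [set: X] ->
  (forall f, integral_signed f nu = 0) -> nu = 0.
Proof.
move=> lcX nu0.
suff H (K : set X) : compact K -> nu K = 0.
  apply/val_inj/funext => A; change (nu A = 0).
  have [nuN nus0 _ nur] := signed_measureP nu.
  have [mA|] := pselect (measurable A); last exact: nuN.
  apply/eqP; rewrite -normr_eq0 eq_le normr_ge0 andbT; apply/ler_addgt0Pl => e e0.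
  have [K [U [cK oU KA AU BUK]]] := nur A e mA e0.
  rewrite addr0 ltW//; have mK := borel_compact cK.
  have -> : nu A = nu (A `\` K).
    apply: EFin_inj; rewrite -[LHS]/(charge_of nu A) (chargeDI (charge_of nu) mA mK).
    by rewrite (setIidr KA) -EFinD; congr EFin; rewrite (H _ cK) addr0.
  by apply: BUK; [exact: measurableD|move=> x [Ax nKx]; split=> //; exact: AU].
move=> cK; have mK := borel_compact cK.
have [g [g01 gK _]] := C0_urysohn lcX cK openT (@subsetT _ K).
have oK : open (~` K) by apply: closed_openC; apply: compact_closed cK; exact: metric_hausdorff.
have [u [cu u0 uK uC]] := open_cozero oK.
have vh (n : nat) : vanishing_continuous (fun x => Num.max (g x - n%:R * u x) 0).
  apply: (@vanishing_continuous_dominated _ _ _ g) => x.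
    apply: (@continuous_max R X (fun x => g x - n%:R * u x) (fun=> 0)); last exact: cvg_cst.
    by apply: cvgB; [exact: C0_continuous|apply: cvgM; [exact: cvg_cst|exact: cu]].
  rewrite !ger0_norm ?le_max ?lexx ?orbT//; last by have /andP[] := g01 x.
  by rewrite ge_max gerBl mulr_ge0//=; have /andP[] := g01 x.
have bK : bounded_measurable (\1_K : X -> R) by exact: indic_bounded_measurable.
have gx n x : `|mkC0 (vh n) x| <= 1.
  rewrite ger0_norm ?le_max ?lexx ?orbT// ge_max ler01 andbT.
  by have /andP[_] := g01 x; apply: le_trans; rewrite gerBl mulr_ge0.
have cvgK x : mkC0 (vh n) x @[n --> \oo] --> (\1_K : X -> R) x.
  rewrite indicE; case: (boolP (x \in K)) => [|]; rewrite ?inE ?notin_setE => Kx.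
    apply: cvg_near_cst; apply: nearW => n /=.
    by rewrite gK// uK ?mulr0 ?subr0 ?max_l//; apply/not_notP.
  apply: cvg_near_cst; exists (Num.truncn (u x)^-1).+1 => // n /= xn.
  have ux := uC _ Kx; have /andP[_ g1] := g01 x.
  rewrite max_r// subr_le0 (le_trans g1)// -ler_pdivrMr// mul1r.
  by rewrite (le_trans (ltW (truncnS_gt _)))// ler_nat.
have bh n := C0_bounded_measurable (mkC0 (vh n)).
have := integral_signed_dominated (nu := nu) bh bK gx cvgK.
under eq_cvg do rewrite nu0.
move=> /(cvg_lim (@Rhausdorff _)); rewrite lim_cst//.
rewrite integral_signed_jordan /Rintegral !integral_indic// !setIT.
move=> /esym; rewrite -fineB ?measure_le_fin ?pos_part_fin ?neg_part_fin//.
by rewrite -signed_measure_jordan.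
Qed.

Lemma signed_measure_ext nu mu : locally_compact [set: X] ->
  (forall f, integral_signed f nu = integral_signed f mu) -> nu = mu.
Proof.
move=> lcX numu; apply/eqP; rewrite -subr_eq0; apply/eqP/integral_signed_eq0 => // f.
have bf := C0_bounded_measurable f.
by rewrite integral_signedD// integral_signedN// numu subrr.
Qed.

End representation.

Section pushforward.
Context {R : realType} {S : semigroupType} {X : pmetricType R} (a : proper_action S X).
Notation borelX := (borel X).

Lemma integral_signed_koopman_dual (s : S) (nu : signed_measure X) (f : C0 R X) :
  integral_signed f (koopman_dual a s nu) = integral_signed (koopman a s f) nu.
Proof.
have ms : measurable_fun [set: borelX] (a s : borelX -> borelX).
  exact: borel_continuous (@act_continuous _ _ a s).
pose P (m : {measure set borelX -> \bar R}) : {measure set borelX -> \bar R} :=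
  measure_function_pushforward__canonical__measure_function_Measure m ms.
have PE m A : P m A = m (a s @^-1` A) by [].
rewrite (@integral_signedE _ _ _ (P (pos_part nu)) (P (neg_part nu))).
- have D (m : {measure set borelX -> \bar R}) : (m setT < +oo)%E ->
    Rintegral (P m) setT f = Rintegral m setT (koopman a s f).
    move=> mT; rewrite /Rintegral; congr fine.
    have mT' : (P m setT < +oo)%E by [].
    have bf := C0_bounded_measurable f.
    have mf := measurable_int _ (bounded_measurable_integrable mT' bf).
    apply: (integral_pushforward ms mf) => //.
    exact: (bounded_measurable_integrable mT (C0_bounded_measurable (koopman a s f))).
  by rewrite !D ?pos_part_fin ?neg_part_fin.
- exact: pos_part_fin.
- exact: neg_part_fin.
- move=> A mA; rewrite !PE -signed_measure_jordan.
    by congr EFin; rewrite /= /koopman_dual_fun asboolT.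
  by rewrite -[X in measurable X]setTI; exact: (ms measurableT A mA).
- exact: C0_bounded_measurable.
Qed.

End pushforward.

(** * Averages and Folner sequences *)

Section fset_means.
Context {R : realType} {T : choiceType} (A : {fset T}).
Hypothesis A0 : A != fset0.

Lemma fset_mean_cst (V : lmodType R) (v : V) : #|` A|%:R^-1 *: \sum_(t <- A) v = v.
Proof.
rewrite big_const_seq count_predT iter_addr_0 -[v *+ _]scaler_nat scalerA mulVf ?scale1r//.
by rewrite pnatr_eq0 cardfs_eq0.
Qed.

Lemma fset_mean_cstR (c : R) : #|` A|%:R^-1 * \sum_(t <- A) c = c.
Proof. exact: (fset_mean_cst (c : R^o)). Qed.

End fset_means.

Section averages.
Context {R : realType} {S : semigroupType} {V : lmodType R}.
Variable T : S -> V -> V.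
Hypothesis Tlin : forall s (c : R) v w, T s (c *: v + w) = c *: T s v + T s w.

Lemma average_linear F (c : R) v w :
  average T F (c *: v + w) = c *: average T F v + average T F w.
Proof.
rewrite /average (eq_bigr _ (fun t _ => Tlin t c v w)) big_split /=.
by rewrite -scaler_sumr scalerDr !scalerA mulrC.
Qed.

Lemma averageD F v w : average T F (v + w) = average T F v + average T F w.
Proof. by have := average_linear F 1 v w; rewrite !scale1r. Qed.

Lemma average0 F : average T F 0 = 0.
Proof. by apply: additive0 => v w; exact: averageD. Qed.

Lemma averageZ F (c : R) v : average T F (c *: v) = c *: average T F v.
Proof. by have := average_linear F c v 0; rewrite average0 !addr0. Qed.

Lemma averageB F v w : average T F (v - w) = average T F v - average T F w.
Proof. by rewrite -scaleN1r averageD averageZ scaleN1r. Qed.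

Lemma average_fixed F v : F != fset0 -> (forall s, T s v = v) -> average T F v = v.
Proof.
move=> F0 Tv; rewrite /average (eq_bigr (fun=> v)) => [|i _]; last exact: Tv.
exact: fset_mean_cst.
Qed.

End averages.

Section folner.
Context {R : realType} {S : semigroupType}.
Hypothesis bc : bicancellative S.
Implicit Types (A B : {fset S}) (F G : nat -> {fset S}).

Definition left_translate (s : S) A : {fset S} := [fset (s * t)%g | t in A]%fset.
Definition right_translate (s : S) A : {fset S} := [fset (t * s)%g | t in A]%fset.

Lemma mulIs (s : S) : injective (fun t : S => (t * s)%g).
Proof. by move=> t1 t2 E; apply: (bc (s := s)); left. Qed.

Lemma mulsI (s : S) : injective (fun t : S => (s * t)%g).
Proof. by move=> t1 t2 E; apply: (bc (s := s)); right. Qed.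

Lemma card_left_translate s A : #|` left_translate s A| = #|` A|.
Proof. by rewrite card_imfset//; exact: mulsI. Qed.

Lemma card_right_translate s A : #|` right_translate s A| = #|` A|.
Proof. by rewrite card_imfset//; exact: mulIs. Qed.

Lemma right_translateD s A B :
  right_translate s (A `\` B)%fset = (right_translate s A `\` right_translate s B)%fset.
Proof.
apply/fsetP => x; rewrite inE; apply/imfsetP/andP => [[t /=]|[nB /imfsetP[t /= tA xE]]].
  rewrite inE => /andP[tB tA] ->; split; last by apply/imfsetP; exists t.
  by apply/imfsetP => -[t' /= t'B /mulIs tt']; rewrite tt' t'B in tB.
exists t => //=; rewrite inE tA andbT; apply: contra nB => tB.
by rewrite xE; apply/imfsetP; exists t.
Qed.

Lemma right_translate_fsymdiff s A B :
  fsymdiff (right_translate s A) (right_translate s B) = right_translate s (fsymdiff A B).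
Proof. by rewrite /fsymdiff -!right_translateD /right_translate imfsetU. Qed.

Lemma left_right_translate s r A :
  left_translate s (right_translate r A) = right_translate r (left_translate s A).
Proof.
apply/fsetP => x; apply/imfsetP/imfsetP => -[y /= /imfsetP[t /= tA ->] ->].
  by exists (s * t)%g; rewrite /= ?mulgA//; apply/imfsetP; exists t.
by exists (t * r)%g; rewrite /= ?mulgA//; apply/imfsetP; exists t.
Qed.

(** Left and right translations commute, and right translations preserve
    cardinalities by cancellation. *)
Lemma left_folner_right_translate F s :
  left_folner R F -> left_folner R (fun n => right_translate s (F n)).
Proof.
move=> [F0 FF]; split=> [n|r]; first by rewrite -cardfs_gt0 card_right_translate cardfs_gt0.
rewrite [X in X @ _ --> _](_ : _ = (fun n => #|` fsymdiff (left_translate r (F n)) (F n)|%:R /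
  #|` F n|%:R : R)); first exact: FF.
apply/funext => n; rewrite -/(left_translate r _) left_right_translate right_translate_fsymdiff.
by rewrite !card_right_translate.
Qed.

Lemma left_folner_comp F (k : nat -> nat) : (forall n, (n <= k n)%N) ->
  left_folner R F -> left_folner R (F \o k).
Proof.
move=> kn [F0 FF]; split=> [n|s]; first exact: F0.
have kcvg : k n @[n --> \oo] --> \oo.
  by move=> A [N _ NA]; exists N => // n /= Nn; apply: NA => /=; exact: leq_trans (kn n).
exact: (cvg_comp _ _ kcvg (FF s)).
Qed.

Definition interleave {T} (u v : nat -> T) (n : nat) := if odd n then v n./2 else u n./2.

Lemma interleave_comp {T U} (h : T -> U) (u v : nat -> T) :
  h \o interleave u v = interleave (h \o u) (h \o v).
Proof. by apply/funext => n; rewrite /interleave /=; case: odd. Qed.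

Lemma cvg_interleave (T : topologicalType) (u v : nat -> T) (l : T) :
  u @ \oo --> l -> v @ \oo --> l -> interleave u v @ \oo --> l.
Proof.
move=> ul vl A Al; have [N _ NA] := ul A Al; have [N' _ NA'] := vl A Al.
(* n./2 is beyond both thresholds once n is beyond their double. *)
exists (maxn N N').*2 => // n /= Nn; rewrite /interleave; case: ifP => _.
  by apply: NA' => /=; lia.
by apply: NA => /=; lia.
Qed.

Lemma left_folner_interleave F G : left_folner R F -> left_folner R G ->
  left_folner R (interleave F G).
Proof.
move=> [F0 FF] [G0 GG]; split=> [n|s]; first by rewrite /interleave; case: ifP.
have /= := cvg_interleave (FF s) (GG s).
by rewrite -(interleave_comp (fun A => #|` fsymdiff (left_translate s A) A|%:R / #|` A|%:R : R)).
Qed.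

(** The interleaving of two Folner sequences is one, and its limit is the limit
    along both subsequences. *)
Lemma folner_limit_unique (V : ptopologicalType) (u : {fset S} -> V) :
  hausdorff_space V ->
  (forall F, left_folner R F -> cvgn (fun n => u (F n))) ->
  forall F G (l l' : V), left_folner R F -> left_folner R G ->
    u (F n) @[n --> \oo] --> l -> u (G n) @[n --> \oo] --> l' -> l = l'.
Proof.
move=> hV cu F G l l' fF fG Fl Gl'.
have /cvg_ex[m Hm] := cu _ (left_folner_interleave fF fG).
have double_cvg (b : bool) : (b + n.*2)%N @[n --> \oo] --> \oo.
  move=> A [N _ NA]; exists N => // n /= Nn; apply: NA => /=; lia.
have IF n : interleave F G (false + n.*2) = F n.
  by rewrite /interleave add0n odd_double doubleK.
have IG n : interleave F G (true + n.*2) = G n.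
  by rewrite /interleave add1n oddS odd_double /= uphalf_double.
have E : u (F n) @[n --> \oo] --> m.
  by under eq_fun do rewrite -IF; exact: (cvg_comp _ _ (double_cvg false) Hm).
have O : u (G n) @[n --> \oo] --> m.
  by under eq_fun do rewrite -IG; exact: (cvg_comp _ _ (double_cvg true) Hm).
by rewrite (cvg_unique hV Fl E) (cvg_unique hV Gl' O).
Qed.

End folner.

Section koopman_averages.
Context {R : realType} {S : semigroupType} {X : pmetricType R} (a : proper_action S X).
Implicit Types (f : C0 R X) (nu : signed_measure X).

Lemma koopman_linear s (c : R) f g :
  koopman a s (c *: f + g) = c *: koopman a s f + koopman a s g.
Proof. exact: C0_ext. Qed.

Lemma koopman_comp s t f : koopman a s (koopman a t f) = koopman a (t * s)%g f.
Proof. by apply: C0_ext => x /=; rewrite actM. Qed.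

Lemma koopman_norm s f : `|koopman a s f| <= `|f|.
Proof. by apply: C0_normr_le => // x; exact: (C0_le_norm f (a s x)). Qed.

Lemma koopman_dual_linear s (c : R) nu mu :
  koopman_dual a s (c *: nu + mu) = c *: koopman_dual a s nu + koopman_dual a s mu.
Proof.
apply/val_inj/funext => A /=; change (koopman_dual_fun a s (c *: nu + mu) A =
  c * koopman_dual_fun a s nu A + koopman_dual_fun a s mu A).
by rewrite /koopman_dual_fun; case: ifP => // _; rewrite mulr0 addr0.
Qed.

Lemma koopman_dual0 s : koopman_dual a s 0 = 0.
Proof.
apply: additive0 => nu mu.
by have := koopman_dual_linear s 1 nu mu; rewrite !scale1r.
Qed.

Lemma average_koopmanE (F : {fset S}) f x :
  average (koopman a) F f x = #|` F|%:R^-1 * \sum_(t <- F) f (a t x).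
Proof.
change (#|` F|%:R^-1 * (\sum_(t <- F) koopman a t f) x = #|` F|%:R^-1 * \sum_(t <- F) f (a t x)).
by rewrite C0_sumE.
Qed.

Lemma average_koopman_norm (F : {fset S}) f : `|average (koopman a) F f| <= `|f|.
Proof.
have [->|F0] := eqVneq F fset0.
  by rewrite /average big_seq_fset0 scaler0 normr0.
have F0R : 0 < #|` F|%:R :> R by rewrite ltr0n cardfs_gt0.
rewrite /average normrZ ger0_norm ?invr_ge0 ?(ltW F0R)// mulrC ler_pdivrMr//.
rewrite (le_trans (ler_norm_sum _ _ _))// (le_trans (ler_sum _ (fun t _ => koopman_norm t f)))//.
by rewrite big_const_seq count_predT iter_addr_0 mulr_natr.
Qed.

Lemma average_koopman_ge0 (F : {fset S}) f x :
  (forall x, 0 <= f x) -> 0 <= average (koopman a) F f x.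
Proof. by move=> f0; rewrite average_koopmanE mulr_ge0 ?invr_ge0// sumr_ge0. Qed.

(** The terms indexed by the common part of F and G cancel. *)
Lemma average_koopmanB_norm (F G : {fset S}) f : #|` F| = #|` G| ->
  `|average (koopman a) F f - average (koopman a) G f| <=
  #|` fsymdiff F G|%:R / #|` G|%:R * `|f|.
Proof.
move=> FG; have sumle (A : {fset S}) : `|\sum_(t <- A) koopman a t f| <= #|` A|%:R * `|f|.
  rewrite (le_trans (ler_norm_sum _ _ _))// (le_trans (ler_sum _ (fun t _ => koopman_norm t f)))//.
  by rewrite big_const_seq count_predT iter_addr_0 mulr_natl.
rewrite /average FG -scalerBr normrZ ger0_norm ?invr_ge0//.
rewrite mulrAC [leRHS]mulrC ler_wpM2l ?invr_ge0//.
have ID (A B : {fset S}) : \sum_(t <- A) koopman a t f =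
    \sum_(t <- (A `\` B)%fset) koopman a t f + \sum_(t <- (A `&` B)%fset) koopman a t f.
  rewrite (big_fsetID _ (mem B) A) addrC; congr (_ + _); apply: eq_fbigl => x.
    by rewrite !inE/= andbC.
  by rewrite !inE/= andbC.
rewrite (ID F G) (ID G F) (fsetIC G F) opprD addrACA subrr addr0.
rewrite (le_trans (ler_normB _ _))// (le_trans (lerD (sumle _) (sumle _)))//.
rewrite -mulrDl -natrD ler_wpM2r// ler_nat /fsymdiff cardfsU.
rewrite [X in (_ <= _ - X)%N](_ : _ = 0%N) ?subn0//; apply/eqP.
rewrite cardfs_eq0 -fsubset0; apply/fsubsetP => x; rewrite !inE.
by case: (x \in F); case: (x \in G).
Qed.

Hypothesis bc : bicancellative S.

Lemma average_koopman_left_translate (F : {fset S}) s f :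
  average (koopman a) F (koopman a s f) = average (koopman a) (left_translate s F) f.
Proof.
rewrite /average card_left_translate//; congr (_ *: _).
rewrite /left_translate big_imfset/=; last by move=> x y _ _; exact: mulsI.
by apply: eq_bigr => t _; rewrite koopman_comp.
Qed.

Lemma koopman_average_right_translate (F : {fset S}) s f :
  koopman a s (average (koopman a) F f) = average (koopman a) (right_translate s F) f.
Proof.
apply: C0_ext => x; rewrite -[LHS]/(average (koopman a) F f (a s x)) !average_koopmanE.
rewrite card_right_translate//; congr (_ * _).
rewrite /right_translate big_imfset/=; last by move=> y z _ _; exact: mulIs.
by apply: eq_bigr => t _; rewrite actM.
Qed.

(** The average of f - kappa(s) f over F_n is a difference of averages of f over
    F_n and over its left translate. *)
Lemma folner_average_coboundary F s f : left_folner R F ->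
  average (koopman a) (F n) (f - koopman a s f) @[n --> \oo] --> (0 : C0 R X).
Proof.
move=> [F0 FF]; apply/cvgr0Pnorm_lt => e e0.
have f1 : 0 < `|f| + 1 by rewrite ltr_wpDl.
have /cvgr0Pnorm_lt/(_ _ (divr_gt0 e0 f1)) := FF s; apply: filterS => n.
rewrite averageB; last exact: koopman_linear.
rewrite average_koopman_left_translate distrC ger0_norm ?divr_ge0// => Fn.
rewrite (le_lt_trans (average_koopmanB_norm _ _))//; first exact: card_left_translate.
rewrite (@le_lt_trans _ _ (#|` fsymdiff (left_translate s (F n)) (F n)|%:R /
  #|` F n|%:R * (`|f| + 1)))//.
  by rewrite ler_wpM2l ?divr_ge0// lerDl.
by rewrite -ltr_pdivlMr.
Qed.

Lemma integral_signed_sum I (r : seq I) (nu_ : I -> signed_measure X) f :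
  integral_signed f (\sum_(i <- r) nu_ i) = \sum_(i <- r) integral_signed f (nu_ i).
Proof.
have bf := C0_bounded_measurable f.
apply: (big_morph (fun nu => integral_signed f nu)) => [nu mu|].
  exact: integral_signedD.
exact: integral_signed0.
Qed.

Lemma integral_signed_suml I (r : seq I) (f_ : I -> C0 R X) nu :
  integral_signed (\sum_(i <- r) f_ i) nu = \sum_(i <- r) integral_signed (f_ i) nu.
Proof.
apply: (big_morph (fun f : C0 R X => integral_signed f nu)) => [f g|].
  exact: integral_signed_addl.
by rewrite -[0](scale0r (0 : C0 R X)) integral_signed_scalel mul0r.
Qed.

Lemma integral_signed_average (F : {fset S}) nu f :
  integral_signed f (average (koopman_dual a) F nu) =
  integral_signed (average (koopman a) F f) nu.
Proof.
have bf := C0_bounded_measurable f.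
rewrite /average integral_signedZ// integral_signed_scalel; congr (_ * _).
rewrite integral_signed_sum integral_signed_suml; apply: eq_bigr => t _.
exact: integral_signed_koopman_dual.
Qed.

End koopman_averages.

(** * Weak* convergence and ultrafilters *)

Section weak_star.
Context {R : realType} {X : pmetricType R}.
Implicit Types (f : C0 R X) (nu : signed_measure X).

Lemma weak_star_cvgP {T : Type} (F : set_system T) {FF : Filter F}
    (u : T -> signed_measure X) nu :
  u t @[t --> F] --> nu <->
  forall f, integral_signed f (u t) @[t --> F] --> integral_signed f nu.
Proof.
pose ev (mu : signed_measure X) : {ptws C0 R X -> R} := fun f => integral_signed f mu.
have evc : continuous ev by exact: initial_continuous.
split=> [unu f|H].
  have /pointwise_cvgP/(_ f) : ev (u t) @[t --> F] --> ev nu.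
    by apply: cvg_comp unu _; exact: evc.
  by [].
have evu : ev (u t) @[t --> F] --> ev nu by apply/pointwise_cvgP => f; exact: H.
move=> A /= [B [[C oC CB] Bnu] BA]; apply: (@filterS _ _ _ (u @^-1` B)).
  by move=> t; exact: BA.
have nC : nbhs (ev nu) C by apply: open_nbhs_nbhs; split=> //; rewrite -CB in Bnu.
by rewrite -CB; exact: evu nC.
Qed.

Lemma weak_star_continuous f : continuous (fun nu => integral_signed f nu).
Proof.
move=> nu; have H := (@weak_star_cvgP _ _ (nbhs_filter nu) id nu).1.
by apply: H; exact: cvg_id.
Qed.

Lemma weak_star_hausdorff : locally_compact [set: X] ->
  hausdorff_space (signed_measure X).
Proof.
move=> lcX nu mu numu; apply: signed_measure_ext => // f.
apply: (@Rhausdorff R) => A B nA nB.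
have [eta [Aeta Beta]] := numu _ _ (weak_star_continuous nA) (weak_star_continuous nB).
by exists (integral_signed f eta).
Qed.

End weak_star.

Section ultrafilters.
Context {R : realType}.

(** An ultrafilter converges to each of its cluster points. *)
Lemma ultra_bounded_cvg {T} (U : set_system T) (u : T -> R) (C : R) : UltraFilter U ->
  (forall t, `|u t| <= C) -> exists l : R, u t @[t --> U] --> l.
Proof.
move=> UU uC; have [|p [_ clp]] := @segment_compact _ (- C) C (fmap u U) _.
  by apply: (@filterS _ U _ setT) filterT => t _; rewrite /= in_itv /= -ler_norml; exact: uC.
exists p => A pA; have [//|nA] := in_ultra_setVsetC (u @^-1` A) UU.
by have [y [nAy Ay]] := clp (~` A) A nA pA.
Qed.

Lemma ultra_nat_exists : exists U : set_system nat, UltraFilter U /\ \oo `<=` U.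
Proof. exact: ultraFilterLemma. Qed.

(** If u did not converge, some neighbourhood would be missed by an ultrafilter
    containing the complement of its preimage. *)
Lemma cvg_ultra {T : topologicalType} (u : nat -> T) (l : T) :
  (forall U : set_system nat, UltraFilter U -> \oo `<=` U -> u @ U --> l) ->
  u @ \oo --> l.
Proof.
move=> H A lA; apply: contrapT => nA.
have PF : ProperFilter (within (~` (u @^-1` A)) \oo).
  split; last exact: within_filter.
  by rewrite /within /= => h; apply: nA; apply: filterS h => n /= h; exact: contrapT.
have [U [UU sU]] := ultraFilterLemma PF.
have UA : U (u @^-1` A) by apply: H => // B oB; apply: sU; apply: filterS oB => n Bn _.
have UnA : U (~` (u @^-1` A)) by apply: sU; exact: withinT.
by have [n []] := filter_ex (filterI UA UnA).
Qed.

End ultrafilters.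

Section C0_complete.
Context {R : realType} {X : topologicalType}.

Lemma C0_uniform_limit (u : nat -> C0 R X) (l : X -> R) :
  (forall e, 0 < e -> exists N, forall n, (N <= n)%N -> forall x, `|u n x - l x| <= e) ->
  exists f : C0 R X, u n @[n --> \oo] --> f.
Proof.
move=> H; have cl : continuous l.
  move=> x; apply/cvgrPdist_le => e e0; have e30 : 0 < e / 3 by rewrite divr_gt0.
  have [N /(_ N (leqnn N)) HN] := H _ e30.
  have /cvgrPdist_le/(_ _ e30) := @C0_continuous _ _ (u N) x; apply: filterS => y uxy.
  have := HN x; have := HN y; move: uxy; rewrite !ler_norml; lra.
have vl : vanishing_continuous l.
  split=> // e e0; have e20 : 0 < e / 2 by rewrite divr_gt0.
  have [N /(_ N (leqnn N)) HN] := H _ e20; have [_ vu] := C0P (u N).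
  apply: (compact_superlevel cl (vu _ e20)) => x /= elx.
  have := HN x; rewrite distrC => /(le_trans (lerB_dist _ _)); lra.
exists (mkC0 vl); apply/cvgrPdist_le => e e0; have [N HN] := H _ e0.
by exists N => // n Nn; apply: C0_normr_le => [|x]; [exact: ltW|rewrite distrC; exact: HN].
Qed.

Lemma C0_complete (u : nat -> C0 R X) :
  (forall e, 0 < e -> exists N, forall n m, (N <= n)%N -> (N <= m)%N ->
    forall x, `|u n x - u m x| <= e) -> cvgn u.
Proof.
move=> H; have cu x : cvgn (fun n => u n x).
  apply/cauchy_cvgP/cauchy_exP => e e0; have e20 : 0 < e / 2 by rewrite divr_gt0.
  have [N HN] := H _ e20; exists (u N x), N => // n Nn /=.
  by rewrite /ball/= (le_lt_trans (HN _ _ (leqnn N) Nn x))// ltr_pdivrMr// ltr_pMr// ltr1n.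
have [|f uf] := @C0_uniform_limit u (fun x => limn (fun n => u n x)); last first.
  by apply/cvg_ex; exists f.
move=> e /H[N HN]; exists N => n Nn x; rewrite distrC.
have : `|u n x - u m x| @[m --> \oo] --> `|u n x - limn (fun n => u n x)|.
  by apply: cvg_norm; apply: cvgB; [exact: cvg_cst|exact: cu].
rewrite distrC => /cvg_lim <-//; apply: limr_le.
  by apply: is_cvg_norm; apply: is_cvgB; [exact: is_cvg_cst|exact: cu].
by exists N => // m Nm; exact: HN.
Qed.

(** The failure of uniform convergence is witnessed by points, which is what the
    compactness argument starts from. *)
Lemma C0_not_cauchy (u : nat -> C0 R X) : ~ cvgn u ->
  exists e (p q : nat -> nat) (x : nat -> X), [/\ 0 < e, forall k, (k <= p k)%N,
    forall k, (k <= q k)%N & forall k, e < `|u (p k) (x k) - u (q k) (x k)|].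
Proof.
move=> nu; suff [e [e0 /choice[w Hw]]] : exists e, 0 < e /\ forall N,
    exists w : (nat * nat) * X, [/\ (N <= w.1.1)%N, (N <= w.1.2)%N &
    e < `|u w.1.1 w.2 - u w.1.2 w.2|].
  exists e, (fun k => (w k).1.1), (fun k => (w k).1.2), (fun k => (w k).2).
  by split=> // k; have [] := Hw k.
apply: contrapT => H; apply: nu; apply: C0_complete => e e0.
apply: contrapT => HN; apply: H; exists e; split=> // N.
apply: contrapT => HN'; apply: HN; exists N => n m Nn Nm x.
by rewrite leNgt; apply/negP => enm; apply: HN'; exists ((n, m), x).
Qed.

End C0_complete.

(** * Limits of averaged point masses *)

Section spans.
Context {R : realType} {V : lmodType R} (A : set V).

Lemma linear_span0 : linear_span A 0.
Proof. by exists 0%N, (fun=> 0), (fun=> 0); split; [case|rewrite big_ord0]. Qed.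

Lemma sub_linear_span : A `<=` linear_span A.
Proof.
by move=> v Av; exists 1%N, (fun=> 1), (fun=> v); split=> //; rewrite big_ord1 scale1r.
Qed.

Lemma linear_spanD v w : linear_span A v -> linear_span A w -> linear_span A (v + w).
Proof.
move=> [n [c [x [Ax ->]]]] [m [d [y [Ay ->]]]].
exists (n + m)%N,
  (fun i : 'I_(n + m) => match fintype.split i with inl j => c j | inr k => d k end),
  (fun i : 'I_(n + m) => match fintype.split i with inl j => x j | inr k => y k end).
split.
  by move=> i; case: fintype.split.
rewrite big_split_ord /=; congr (_ + _); apply: eq_bigr => i _.
  by rewrite (unsplitK (inl i)).
by rewrite (unsplitK (inr i)).
Qed.

Lemma linear_spanZ (k : R) v : linear_span A v -> linear_span A (k *: v).
Proof.
move=> [n [c [x [Ax ->]]]]; exists n, (fun i => k * c i), x; split=> //.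
by rewrite scaler_sumr; apply: eq_bigr => i _; rewrite scalerA.
Qed.

Lemma linear_span_sum I (r : seq I) (v : I -> V) :
  (forall i, linear_span A (v i)) -> linear_span A (\sum_(i <- r) v i).
Proof.
move=> Av; elim/big_ind : _ => //; first exact: linear_span0.
exact: linear_spanD.
Qed.

Lemma linear_span_ker (W : zmodType) (L : V -> W) :
  (forall v w, L (v + w) = L v + L w) -> (forall (k : R) v, L v = 0 -> L (k *: v) = 0) ->
  (forall v, A v -> L v = 0) -> forall v, linear_span A v -> L v = 0.
Proof.
move=> LD LZ LA v [n [c [w [Aw ->]]]].
by rewrite (big_morph L LD (additive0 LD)) big1// => i _; apply: LZ; exact: LA.
Qed.

End spans.

(** v - A_F v is the mean of the coboundaries v - T t v. *)
Lemma average_coboundary (R : realType) (S : semigroupType) (V : lmodType R)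
  (T : S -> V -> V) (F : {fset S}) v : F != fset0 ->
  linear_span [set w | exists u s, w = u - T s u] (v - average T F v).
Proof.
move=> F0; have -> : v - average T F v = #|` F|%:R^-1 *: \sum_(t <- F) (v - T t v).
  by rewrite sumrB scalerBr fset_mean_cst.
apply/linear_spanZ/linear_span_sum => t; apply: sub_linear_span.
by exists v, t.
Qed.

Lemma closure_limit (T : topologicalType) (U : set_system nat) (u : nat -> T) l
  (A : set T) : ProperFilter U -> (forall n, A (u n)) -> u n @[n --> U] --> l -> closure A l.
Proof.
move=> UU Au ul B nB; have /filter_ex[n Bn] : U (u @^-1` B) by exact: ul.
by exists (u n).
Qed.

Lemma cvg_le_bound (R : realType) (T : Type) (U : set_system T) (u : T -> R) (l c : R) :
  ProperFilter U -> u t @[t --> U] --> l -> (forall t, u t <= c) -> l <= c.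
Proof.
move=> FU ul uc; rewrite leNgt; apply/negP => cl.
move/cvgrPdist_lt : ul => /(_ (l - c)); rewrite subr_gt0 => /(_ cl)/filter_ex[t].
move: (uc t); rewrite ltr_norml; move: (u t) => v vc /andP[_]; rewrite ltrD2l ltrN2.
by rewrite ltNge vc.
Qed.

Section folner_limits.
Context {R : realType} {S : semigroupType} {X : pmetricType R} (a : proper_action S X).
Hypothesis bc : bicancellative S.
Hypothesis lcX : locally_compact [set: X].
Implicit Types (f : C0 R X) (nu eta : signed_measure X) (F G : nat -> {fset S}).

(** The integral of f against A*_{F_n} delta_{x_n} is A_{F_n} f(x_n), so [eta] is
    the weak* limit of these measures along U. *)
Definition folner_limit F (x : nat -> X) (U : set_system nat) eta :=
  [/\ nonnegative eta, eta setT <= 1, koopman_dual_fix a eta &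
    forall f, average (koopman a) (F n) f (x n) @[n --> U] --> integral_signed f eta].

(** The compactness of the subprobabilities in the form needed here: Riesz
    representation applied to the limit of the functionals along U. *)
Lemma positive_functional_limit (L_ : nat -> C0 R X -> R) (U : set_system nat) :
  UltraFilter U ->
  (forall n f g, L_ n (f + g) = L_ n f + L_ n g) ->
  (forall n (c : R) f, L_ n (c *: f) = c * L_ n f) ->
  (forall n f, (forall x, 0 <= f x) -> 0 <= L_ n f) ->
  (forall n f, `|L_ n f| <= `|f|) ->
  exists eta, [/\ nonnegative eta,
    forall V c, open V -> (forall f, subordinate f V -> integral_signed f eta <= c) -> eta V <= c &
    forall f, L_ n f @[n --> U] --> integral_signed f eta].
Proof.
move=> UU LD LZ L_ge0 LM.
have [L HL] := choice (fun f => ultra_bounded_cvg UU (LM ^~ f)).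
have uniq (u : nat -> R) (l l' : R) : u @ U --> l -> u @ U --> l' -> l = l'.
  by move=> ul ul'; exact: (cvg_unique (@Rhausdorff R) ul ul').
have [|c f|f f0|f|eta [eta0 etaU etaL]] := @riesz_representation R X L 1.
- move=> f g; apply: (uniq (fun n => L_ n (f + g))); first exact: HL.
  by under eq_fun do rewrite LD; apply: cvgD; exact: HL.
- apply: (uniq (fun n => L_ n (c *: f))); first exact: HL.
  by under eq_fun do rewrite LZ; apply: cvgM; [exact: cvg_cst|exact: HL].
- rewrite -oppr_le0; apply: (cvg_le_bound (u := fun n => - L_ n f) (U := U)).
    by apply: cvgN; exact: HL.
  by move=> n; rewrite oppr_le0 L_ge0.
- rewrite mul1r; apply: (cvg_le_bound (u := fun n => `|L_ n f|) (U := U)) => //.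
  by apply: cvg_norm; exact: HL.
exists eta; split=> // [V c oV H|f]; last by rewrite etaL; exact: HL.
by apply: etaU => // f fV; rewrite -etaL; exact: H.
Qed.

(** Invariance comes from the vanishing of the averages of coboundaries. *)
Lemma folner_limit_exists F x U : left_folner R F -> UltraFilter U -> \oo `<=` U ->
  exists2 eta, folner_limit F x U eta & forall V c, open V ->
    (forall f, subordinate f V -> integral_signed f eta <= c) -> eta V <= c.
Proof.
move=> fF UU Uoo; have lin s := @koopman_linear R S X a s.
have [n f g|n c f|n f f0|n f|eta [eta0 etaV etaL]] :=
    @positive_functional_limit (fun n f => average (koopman a) (F n) f (x n)) U UU.
- by rewrite averageD.
- by rewrite averageZ.
- exact: average_koopman_ge0.
- by rewrite (le_trans (C0_le_norm _ _))//; exact: average_koopman_norm.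
exists eta => //; split=> // [|s].
  apply: etaV; first exact: openT.
  move=> f [f01 _]; have f1 : `|f| <= 1.
    by apply: C0_normr_le => // y; have /andP[f0 f1] := f01 y; rewrite ger0_norm.
  apply: (cvg_le_bound _ (etaL f)) => n; rewrite (le_trans (ler_norm _))//.
  by rewrite (le_trans (C0_le_norm _ _))// (le_trans (average_koopman_norm _ _ _)).
apply: signed_measure_ext => // f; rewrite integral_signed_koopman_dual.
apply/eqP; rewrite eq_sym -subr_eq0; apply/eqP.
have c1 : average (koopman a) (F n) (f - koopman a s f) (x n) @[n --> U] -->
    integral_signed f eta - integral_signed (koopman a s f) eta.
  by under eq_fun do rewrite averageB//; apply: cvgB; exact: etaL.
have c2 : average (koopman a) (F n) (f - koopman a s f) (x n) @[n --> U] --> (0 : R).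
  have := folner_average_coboundary a bc s f fF; move=> /cvgr0Pnorm_lt H.
  apply/cvgr0Pnorm_lt => e e0; apply: Uoo; apply: filterS (H e e0) => n.
  by apply: le_lt_trans; exact: C0_le_norm.
exact: (cvg_unique (@Rhausdorff R) c1 c2).
Qed.

(** Evaluation at x is a positive functional. *)
Lemma dirac_exists (x : X) : exists d : signed_measure X,
  subprobabilities d /\ forall f, integral_signed f d = f x.
Proof.
have [//|//|f f0|f|d [d0 dU dL]] := @riesz_representation R X (fun f => f x) 1.
- exact: f0.
- by rewrite mul1r C0_le_norm.
exists d; split=> //; split=> //; apply: dU; first exact: openT.
by move=> f [f01 _]; have /andP[] := f01 x.
Qed.

(** The two sequences of indices witnessing the failure of the Cauchy property
    are turned into two Folner sequences at the same points. *)
Lemma uniform_of_unique_limits :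
  (forall F G x U eta eta', left_folner R F -> left_folner R G -> UltraFilter U ->
    folner_limit F x U eta -> folner_limit G x U eta' -> eta = eta') ->
  uniform_action a.
Proof.
move=> H F fF f; apply: contrapT => /C0_not_cauchy[e [p [q [x [e0 kp kq He]]]]].
have [U [UU Uoo]] := ultra_nat_exists.
have fFp := left_folner_comp kp fF; have fFq := left_folner_comp kq fF.
have [eta He1 _] := folner_limit_exists x fFp UU Uoo.
have [eta' He2 _] := folner_limit_exists x fFq UU Uoo.
have E := H _ _ _ _ _ _ fFp fFq UU He1 He2; rewrite -{eta'}E in He2.
have [_ _ _ /(_ f) c1] := He1; have [_ _ _ /(_ f) c2] := He2.
have /cvgr0Pnorm_lt/(_ e e0)/filter_ex[k ke] :
    (average (koopman a) (F (p k)) f (x k) - average (koopman a) (F (q k)) f (x k))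
    @[k --> U] --> (0 : R).
  by rewrite -[0](subrr (integral_signed f eta)); exact: (cvgB c1 c2).
by have := lt_trans ke (He k); rewrite ltxx.
Qed.

Lemma average_koopman_dual_limit F x U {FU : Filter U} eta (d : nat -> signed_measure X) :
  (forall n f, integral_signed f (d n) = f (x n)) ->
  folner_limit F x U eta -> average (koopman_dual a) (F n) (d n) @[n --> U] --> eta.
Proof.
move=> dE [_ _ _ H]; apply/weak_star_cvgP => f.
by under eq_fun do rewrite integral_signed_average dE; exact: H.
Qed.

(** With d_n the point mass at x_n, both A*_{F_n} d_n and A*_{G_n} d_n differ
    from d_n by a coboundary, so their limits differ by an element of the weak*
    closure of the coboundaries, and both limits are invariant. *)
Lemma uniform_of_dual_direct_sum :
  koopman_dual_fix a `&` closure (koopman_dual_cob a) = [set 0] -> uniform_action a.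
Proof.
move=> H; apply: uniform_of_unique_limits => F G x U eta eta' fF fG UU etaF etaG.
have [d dE] := choice (fun n => dirac_exists (x n)).
have dE2 n f : integral_signed f (d n) = f (x n) by have [_] := dE n; apply.
have c1 : average (koopman_dual a) (F n) (d n) @[n --> U] --> eta.
  exact: average_koopman_dual_limit.
have c2 : average (koopman_dual a) (G n) (d n) @[n --> U] --> eta'.
  exact: average_koopman_dual_limit.
suff : (koopman_dual_fix a `&` closure (koopman_dual_cob a)) (eta - eta').
  by rewrite H => /= /eqP; rewrite subr_eq0 => /eqP.
split.
  move=> s; have [_ _ f1 _] := etaF; have [_ _ f2 _] := etaG.
  by rewrite -scaleN1r addrC koopman_dual_linear f1 f2.
apply: (@closure_limit _ U (fun n => average (koopman_dual a) (F n) (d n) -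
  average (koopman_dual a) (G n) (d n))) => [n|].
  rewrite -[X in X - _](subrK (d n)) -opprB -addrA addrC.
  apply: linear_spanD; first by apply: average_coboundary; have [] := fG.
  rewrite -scaleN1r; apply: linear_spanZ; apply: average_coboundary.
  by have [] := fF.
apply/weak_star_cvgP => f; have bf := C0_bounded_measurable f.
under eq_fun do rewrite integral_signedD// integral_signedN//.
rewrite integral_signedD// integral_signedN//.
have d1 := (weak_star_cvgP _ _).1 c1 f.
have d2 := (weak_star_cvgP _ _).1 c2 f.
by apply: cvgB; [exact: d1|exact: d2].
Qed.

End folner_limits.

(** * The mean ergodic projection and its adjoint *)

Section projections.
Context {R : realType} {S : semigroupType} {X : pmetricType R} (a : proper_action S X).
Hypothesis bc : bicancellative S.
Hypothesis lcX : locally_compact [set: X].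
Implicit Types (f : C0 R X) (nu eta : signed_measure X) (F G : nat -> {fset S}).

Let klin := @koopman_linear R S X a.

(** The averages are contractions, so convergence to 0 passes from the
    coboundaries to their closure. *)
Lemma average_closure_cob F f : left_folner R F -> closure (koopman_cob a) f ->
  average (koopman a) (F n) f @[n --> \oo] --> (0 : C0 R X).
Proof.
move=> fF clf; apply/cvgr0Pnorm_lt => e e0; have e20 : 0 < e / 2 by rewrite divr_gt0.
have [g [[n [c [w [cw gE]]]] fg]] := clf _ (nbhsx_ballx f _ e20).
have g0 : average (koopman a) (F n) g @[n --> \oo] --> (0 : C0 R X).
  rewrite gE; elim/big_ind : _ => [|h k h0 k0|i _].
  - by under eq_fun do rewrite average0//; exact: cvg_cst.
  - by under eq_fun do rewrite averageD//; rewrite -[0](addr0 (0 : C0 R X)); exact: cvgD.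
  - have [h [s ->]] := cw i; under eq_fun do rewrite averageZ//.
    by rewrite -[0](scaler0 _ (c i)); apply: cvgZr; exact: folner_average_coboundary.
move/cvgr0Pnorm_lt : g0 => /(_ _ e20); apply: filterS => m gm.
rewrite -[f](subrK g) averageD// (le_lt_trans (ler_normD _ _))// (splitr e) ltrD//.
by rewrite (le_lt_trans (average_koopman_norm _ _ _)).
Qed.

Lemma average_koopman_fix F f : left_folner R F -> koopman_fix a f ->
  forall n, average (koopman a) (F n) f = f.
Proof. by move=> [F0 _] ff n; apply: average_fixed. Qed.

Lemma uniform_of_direct_sum :
  is_direct_sum (koopman_fix a) (closure (koopman_cob a)) -> uniform_action a.
Proof.
move=> [sumT _] F fF f; have [g gfix [h hcob <-]] : ([set g + h | g in koopman_fix a &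
    h in closure (koopman_cob a)]) f by rewrite sumT.
apply/cvg_ex; exists (g + 0); under eq_fun do rewrite averageD// (average_koopman_fix fF gfix).
by apply: cvgD; [exact: cvg_cst|exact: average_closure_cob].
Qed.

Lemma norm_limit_le F f g : average (koopman a) (F n) f @[n --> \oo] --> g -> `|g| <= `|f|.
Proof.
move=> fg; apply: (cvg_le_bound (u := fun n => `|average (koopman a) (F n) f|) (U := \oo)).
  exact: cvg_norm.
by move=> n; exact: average_koopman_norm.
Qed.

(** The kernel of the limit operator P is the closure of the coboundaries because
    f - A_{F_n} f is a coboundary and tends to f - P f. *)
Theorem uniform_projection F : uniform_action a -> left_folner R F ->
  exists P : {linear C0 R X -> C0 R X}, is_mean_ergodic_projection a P /\
    forall f, average (koopman a) (F n) f @[n --> \oo] --> P f.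
Proof.
move=> ua fF; have cF f : exists g : C0 R X, average (koopman a) (F n) f @[n --> \oo] --> g.
  by apply/cvg_ex; exact: ua.
have [P0 HP0] := choice cF.
have hC0 : hausdorff_space (C0 R X) by exact: norm_hausdorff.
have Plin : linear P0.
  move=> c f g; have lim : average (koopman a) (F n) (c *: f + g) @[n --> \oo] -->
      c *: P0 f + P0 g.
    under eq_fun do rewrite average_linear//.
    by apply: cvgD; [apply: cvgZr; exact: HP0|exact: HP0].
  exact: (cvg_unique hC0 (HP0 _) lim).
pose P : {linear C0 R X -> C0 R X} := HB.pack P0 (GRing.isLinear.Build _ _ _ _ P0 Plin).
have HP f : average (koopman a) (F n) f @[n --> \oo] --> P f by exact: HP0.
have Pfix f : koopman_fix a (P f).
  move=> s; have c1 : koopman a s (average (koopman a) (F n) f) @[n --> \oo] --> koopman a s (P f).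
    apply/cvgrPdist_lt => e e0; have /cvgrPdist_lt/(_ _ e0) := HP f.
    apply: filterS => n; apply: le_lt_trans.
    have -> : koopman a s (P f) - koopman a s (average (koopman a) (F n) f) =
      koopman a s (P f - average (koopman a) (F n) f) by exact: C0_ext.
    exact: koopman_norm.
  have c2 : average (koopman a) (right_translate s (F n)) f @[n --> \oo] --> koopman a s (P f).
    by under eq_fun do rewrite -koopman_average_right_translate//; exact: c1.
  apply: (folner_limit_unique (u := fun A => average (koopman a) A f) hC0 _
    (left_folner_right_translate bc s fF) fF c2 (HP f)).
  by move=> G fG; exact: ua.
have Pid f : koopman_fix a f -> P f = f.
  move=> ff; have lim : average (koopman a) (F n) f @[n --> \oo] --> f.
    by under eq_fun do rewrite (average_koopman_fix fF ff); exact: cvg_cst.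
  exact: (cvg_unique hC0 (HP f) lim).
have PC : continuous P.
  move=> f; apply/(cvgrPdist_lt (FF := nbhs_filter f)) => e e0.
  apply: filterS (nbhsx_ballx f e e0) => g fg.
  by rewrite -linearB (le_lt_trans (norm_limit_le (HP _))).
exists P; split=> //; split=> //.
- by move=> f; exact: Pid.
- apply/seteqP; split=> [_ [f _ <-]|f ff]; first exact: Pfix.
  by exists f => //; exact: Pid.
- apply/seteqP; split=> f /=.
    move=> Pf; apply: (@closure_limit _ \oo (fun n => f - average (koopman a) (F n) f)).
      by move=> n; apply: average_coboundary; have [] := fF.
    by rewrite -[X in _ --> X]subr0 -Pf; apply: cvgB; [exact: cvg_cst|exact: HP].
  by move=> /(average_closure_cob fF) lim; exact: (cvg_unique hC0 (HP f) lim).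
Qed.

Lemma direct_sum_of_uniform : left_amenable S R -> uniform_action a ->
  is_direct_sum (koopman_fix a) (closure (koopman_cob a)).
Proof.
move=> [F fF] ua; have [P [[PC PP rP kerP] HP]] := uniform_projection ua fF.
have Pfix f : koopman_fix a (P f) by rewrite -rP; exists f.
split; apply/seteqP; split=> // f.
  move=> _; exists (P f) => //; exists (f - P f); last by rewrite addrC subrK.
  by rewrite -kerP /= linearB PP subrr.
  move=> [ff fcob] /=; move: fcob; rewrite -kerP /= => <-.
  by move: ff; rewrite -rP => -[g _ <-]; rewrite PP.
move=> /= ->; split; last by rewrite -kerP /= linear0.
by rewrite -rP; exists 0 => //; rewrite linear0.
Qed.

Section dual_projection.
Variables (F : nat -> {fset S}) (P : {linear C0 R X -> C0 R X}).
Hypotheses (fF : left_folner R F)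
  (HP : forall f, average (koopman a) (F n) f @[n --> \oo] --> P f).

Lemma C0_eval_cvg (u : nat -> C0 R X) f x : u n @[n --> \oo] --> f -> u n x @[n --> \oo] --> f x.
Proof.
move=> /cvgrPdist_lt uf; apply/cvgrPdist_lt => e e0; apply: filterS (uf e e0) => n.
by apply: le_lt_trans; exact: (C0_le_norm (f - u n)).
Qed.

Lemma projection_ge0 f : (forall x, 0 <= f x) -> forall x, 0 <= P f x.
Proof.
move=> f0 x; rewrite -oppr_le0.
apply: (cvg_le_bound (u := fun n => - average (koopman a) (F n) f x) (U := \oo)).
  by apply: cvgN; apply: C0_eval_cvg; exact: HP.
by move=> n; rewrite oppr_le0 average_koopman_ge0.
Qed.

Lemma projection_koopman s f : P (koopman a s f) = P f.
Proof.
apply/eqP; rewrite eq_sym -subr_eq0 -linearB; apply/eqP.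
have hC0 : hausdorff_space (C0 R X) by exact: norm_hausdorff.
exact: (cvg_unique hC0 (@HP _) (folner_average_coboundary a bc s f fF)).
Qed.

Lemma integral_average_cvg nu f :
  integral_signed (average (koopman a) (F n) f) nu @[n --> \oo] --> integral_signed (P f) nu.
Proof.
apply: (@integral_signed_dominated _ _ nu _ _ `|f|).
- by move=> n; exact: C0_bounded_measurable.
- exact: C0_bounded_measurable.
- by move=> n x; rewrite (le_trans (C0_le_norm _ _))//; exact: average_koopman_norm.
- by move=> x; apply: C0_eval_cvg; exact: HP.
Qed.

(** Averaging f does not change its integral against an invariant measure. *)
Lemma integral_projection_fix mu f : koopman_dual_fix a mu ->
  integral_signed f mu = integral_signed (P f) mu.
Proof.
move=> mufix.
have c : integral_signed (average (koopman a) (F n) f) mu @[n --> \oo] -->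
  integral_signed (P f) mu by exact: integral_average_cvg.
have E n : average (koopman_dual a) (F n) mu = mu.
  by apply: average_fixed => //; have [] := fF.
have c' : integral_signed (average (koopman a) (F n) f) mu @[n --> \oo] --> integral_signed f mu.
  by under eq_fun do rewrite -integral_signed_average E; exact: cvg_cst.
exact: (cvg_unique (@Rhausdorff R) c' c).
Qed.

(** P is positive, so the two parts of the Jordan decomposition of nu yield
    positive functionals to which Riesz representation applies. *)
Lemma adjoint_measure_exists nu :
  exists mu, forall f, integral_signed f mu = integral_signed (P f) nu.
Proof.
have repr (m : {measure set (borel X) -> \bar R}) : (m setT < +oo)%E ->
    exists mu, forall f, integral_signed f mu = Rintegral m setT (P f).
  move=> mT; have int f := bounded_measurable_integrable mT (C0_bounded_measurable (P f)).
  have [f g|c f|f f0|f|mu [_ _ muE]] :=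
      @riesz_representation R X (fun f => Rintegral m setT (P f)) (fine (m setT)).
  - by rewrite linearD -RintegralD//; exact: int.
  - by rewrite linearZ -RintegralZl//; exact: int.
  - by apply: Rintegral_ge0 => x _; exact: projection_ge0.
  - apply: le_trans (le_normr_Rintegral measurableT (int f)) _.
    rewrite mulrC -Rintegral_cst//; apply: le_Rintegral => //.
    + exact: integrable_norm (int f).
    + apply: bounded_measurable_integrable => //.
      by split; [exact: measurable_cst|exists `| `|f| |].
    + move=> x _; rewrite (le_trans (C0_le_norm _ _))//; exact: norm_limit_le (@HP f).
  by exists mu.
have [mu1 mu1E] := repr _ (pos_part_fin nu).
have [mu2 mu2E] := repr _ (neg_part_fin nu).
exists (mu1 - mu2) => f; have bf := C0_bounded_measurable f.
by rewrite integral_signedD// integral_signedN// mu1E mu2E integral_signed_jordan.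
Qed.

Lemma dual_projection : exists Q : {linear signed_measure X -> signed_measure X},
  [/\ is_adjoint P Q, range Q `<=` koopman_dual_fix a &
    forall nu, average (koopman_dual a) (F n) nu @[n --> \oo] --> Q nu].
Proof.
have [Q0 HQ] := choice adjoint_measure_exists.
have Qlin : linear Q0.
  move=> c nu mu; apply: signed_measure_ext => // f; rewrite HQ.
  have bf := C0_bounded_measurable f; have bPf := C0_bounded_measurable (P f).
  by rewrite !integral_signedD// !integral_signedZ// !HQ.
pose Q : {linear signed_measure X -> signed_measure X} :=
  HB.pack Q0 (GRing.isLinear.Build _ _ _ _ Q0 Qlin).
exists Q; split=> [f nu|_ [nu _ <-] s|nu].
- exact: HQ.
- apply: signed_measure_ext => // f.
  by rewrite integral_signed_koopman_dual !HQ projection_koopman.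
- apply/weak_star_cvgP => f; rewrite HQ.
  by under eq_fun do rewrite integral_signed_average; exact: integral_average_cvg.
Qed.

End dual_projection.

(** The decomposition is nu = Q nu + (nu - Q nu), the second term being the limit
    of the coboundaries nu - A*_{F_n} nu.  If nu is in both summands, then
    int f dnu = int P f dnu by invariance, and integration of the fixed function
    P f kills the coboundaries and their weak* closure. *)
Lemma dual_direct_sum_of_uniform : left_amenable S R -> uniform_action a ->
  is_direct_sum (koopman_dual_fix a) (closure (koopman_dual_cob a)).
Proof.
move=> [F fF] ua; have [P [[PC PP rP kerP] HP]] := uniform_projection ua fF.
have [Q [adj Qfix HQ]] := dual_projection fF HP.
split; apply/seteqP; split=> // nu.
- move=> _; exists (Q nu); first by apply: Qfix; exists nu.
  exists (nu - Q nu); last by rewrite addrC subrK.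
  apply: (@closure_limit _ \oo (fun n => nu - average (koopman_dual a) (F n) nu)).
    by move=> n; apply: average_coboundary; have [] := fF.
  apply/weak_star_cvgP => f; have bf := C0_bounded_measurable f.
  under eq_fun do rewrite integral_signedD// integral_signedN//.
  rewrite integral_signedD// integral_signedN//.
  apply: cvgB; first exact: cvg_cst.
  have c := (weak_star_cvgP _ _).1 (HQ nu) f; exact: c.
- move=> [nufix nucob] /=; apply: integral_signed_eq0 => // f.
  rewrite (integral_projection_fix fF HP)//; have bPf := C0_bounded_measurable (P f).
  have cl : closed [set mu | integral_signed (P f) mu = 0].
    have := @closed_eq R 0; have /continuous_closedP := @weak_star_continuous R X (P f).
    by move=> H /H.
  have : closure (koopman_dual_cob a) `<=` [set mu | integral_signed (P f) mu = 0].
    rewrite ((closure_id _).1 cl); apply: closure_subset; apply: linear_span_ker.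
    - by move=> mu eta; exact: integral_signedD.
    - by move=> k mu mu0; rewrite integral_signedZ// mu0 mulr0.
    - move=> _ [mu [s ->]]; rewrite integral_signedD// integral_signedN//.
      rewrite integral_signed_koopman_dual.
      have -> : koopman a s (P f) = P f by have : range P (P f); [exists f|rewrite rP; apply].
      by rewrite subrr.
  by apply.
- move=> ->; split.
    by move=> s; exact: koopman_dual0.
  by apply: subset_closure; exact: linear_span0.
Qed.

Lemma weak_star_mean_continuous_of_uniform : uniform_action a -> weak_star_mean_continuous a.
Proof.
move=> ua F fF; have [P [_ HP]] := uniform_projection ua fF.
have [Q [adj _ HQ]] := dual_projection fF HP.
exists Q; split=> [nu _|]; first exact: HQ.
apply: continuous_subspaceT => nu.
apply: (weak_star_cvgP (FF := nbhs_filter nu) Q (Q nu)).2 => f; rewrite adj.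
under eq_fun do rewrite adj.
exact: weak_star_continuous.
Qed.

End projections.

(** * From the other conditions to uniformity, and unique ergodicity *)

Section nonneg_extra.
Context {R : realType} {X : pmetricType R}.
Implicit Types (f : C0 R X) (nu : signed_measure X).

Lemma bounded_measurable_cst (c : R) : bounded_measurable ((fun=> c) : X -> R).
Proof. by split; [exact: measurable_cst|exists `|c|]. Qed.

Lemma integral_signed_norm_le nu f : nonnegative nu ->
  `|integral_signed f nu| <= `|f| * nu setT.
Proof.
move=> nu0; have bf := C0_bounded_measurable f.
rewrite ler_norml -mulNr -!integral_signed_cst//; apply/andP; split;
  apply: le_integral_signed => //; try exact: bounded_measurable_cst.
  by move=> x; have := C0_le_norm f x; rewrite ler_norml => /andP[].
by move=> x; have := C0_le_norm f x; rewrite ler_norml => /andP[].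
Qed.

Lemma integral_signed_constant nu f (E : set X) (c : R) : nonnegative nu -> closed E ->
  nu (~` E) = 0 -> (forall x, E x -> f x = c) -> integral_signed f nu = c * nu setT.
Proof.
move=> nu0 cE nE fE; rewrite -integral_signed_cst// !integral_signed_nonneg//; last 2 first.
- exact: bounded_measurable_cst.
- exact: C0_bounded_measurable.
have mE : measurable (~` E : set (borel X)) by apply: borel_open; exact: closed_openC.
rewrite /Rintegral; congr fine; apply: ae_eq_integral => //.
- by apply/measurable_EFinP; have [] := C0_bounded_measurable f.
- exists (~` E); split=> //; first by rewrite /= measure_of_nonnegE nE.
  by move=> x /= H Ex; apply: H => _; rewrite fE.
Qed.

End nonneg_extra.

Section ergodic.
Context {R : realType} {S : semigroupType} {X : pmetricType R} (a : proper_action S X).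
Hypothesis bc : bicancellative S.
Hypothesis lcX : locally_compact [set: X].
Implicit Types (f : C0 R X) (nu eta : signed_measure X) (F G : nat -> {fset S}).

Lemma average_koopman_dualE (A : {fset S}) nu (B : set (borel X)) :
  average (koopman_dual a) A nu B = #|` A|%:R^-1 * \sum_(t <- A) koopman_dual a t nu B.
Proof.
change (#|` A|%:R^-1 * (\sum_(t <- A) koopman_dual a t nu) B =
  #|` A|%:R^-1 * \sum_(t <- A) koopman_dual a t nu B).
by congr (_ * _); apply: (big_morph (fun mu : signed_measure X => mu B)).
Qed.

Lemma subprobabilities_average (A : {fset S}) nu : A != fset0 ->
  subprobabilities nu -> subprobabilities (average (koopman_dual a) A nu).
Proof.
move=> A0 [nu0 nu1]; split=> [B|]; rewrite average_koopman_dualE.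
  rewrite mulr_ge0 ?invr_ge0// sumr_ge0// => t _.
  by rewrite /= /koopman_dual_fun; case: ifP.
rewrite (eq_bigr (fun=> nu setT)) => [|t _]; last first.
  by rewrite /= /koopman_dual_fun asboolT.
by rewrite fset_mean_cstR.
Qed.

Lemma within_ultra_limit (U : set_system nat) (nu_ : nat -> signed_measure X) nu
    (L : signed_measure X -> signed_measure X) : Filter U ->
  {within @subprobabilities R X, continuous L} -> (forall n, subprobabilities (nu_ n)) ->
  subprobabilities nu -> nu_ n @[n --> U] --> nu -> L (nu_ n) @[n --> U] --> L nu.
Proof.
move=> FU /subspace_continuousP Lc nu_s nus nunu A LA.
have /nunu : nbhs nu [set mu | subprobabilities mu -> A (L mu)] by exact: (Lc nu nus A LA).
by apply: (@filterS _ U) => n; apply.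
Qed.

(** Let L be the limit map of the averages along F.  Pointwise convergence along
    all Folner sequences gives L(delta_{tx}) = L(delta_x) by comparing F with
    its right translate, hence L is constant along A*_{H_n} delta_{x_n} for
    every H; by continuity a limit of these measures, which L fixes, is the
    limit of L(delta_{x_n}). *)
Theorem uniform_of_weak_star_mean_continuous : weak_star_mean_continuous a -> uniform_action a.
Proof.
move=> H5.
have pointwise f x G : left_folner R G -> cvgn (fun n => average (koopman a) (G n) f x).
  move=> fG; have [L [HL _]] := H5 G fG; have [d [ds dE]] := dirac_exists x.
  apply/cvg_ex; exists (integral_signed f (L d)).
  have c := (weak_star_cvgP _ _).1 (HL d ds) f.
  by under eq_fun do rewrite -dE -integral_signed_average; exact: c.
apply: uniform_of_unique_limits => // F G x U eta eta' fF fG UU etaF etaG.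
have hM := weak_star_hausdorff lcX.
have [L [HL Lc]] := H5 F fF.
have [d dP] := choice (fun n => dirac_exists (x n)).
have dE n f : integral_signed f (d n) = f (x n) by have [_] := dP n; apply.
have ds n : subprobabilities (d n) by have [] := dP n.
have Lfix H eta1 : folner_limit a H x U eta1 -> L eta1 = eta1.
  move=> [e0 e1 efix _].
  have c : average (koopman_dual a) (F n) eta1 @[n --> \oo] --> L eta1 by apply: HL.
  have c' : average (koopman_dual a) (F n) eta1 @[n --> \oo] --> eta1.
    have E n : average (koopman_dual a) (F n) eta1 = eta1.
      by apply: average_fixed => //; have [] := fF.
    by under eq_fun do rewrite E; exact: cvg_cst.
  exact: (cvg_unique hM c c').
have Laverage H n : left_folner R H -> L (average (koopman_dual a) (H n) (d n)) = L (d n).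
  move=> [H0 _].
  have sub := subprobabilities_average (H0 n) (ds n).
  have c : average (koopman_dual a) (F k) (average (koopman_dual a) (H n) (d n))
    @[k --> \oo] --> L (average (koopman_dual a) (H n) (d n)) by apply: HL.
  have c' : average (koopman_dual a) (F k) (average (koopman_dual a) (H n) (d n))
      @[k --> \oo] --> L (d n).
    apply/weak_star_cvgP => f.
    have E k : integral_signed f (average (koopman_dual a) (F k)
        (average (koopman_dual a) (H n) (d n))) =
        #|` H n|%:R^-1 * \sum_(t <- H n) average (koopman a) (F k) f (a t (x n)).
      by rewrite !integral_signed_average dE average_koopmanE.
    under eq_fun do rewrite E.
    rewrite -(fset_mean_cstR (H0 n) (integral_signed f (L (d n)))).
    apply: cvgM; first exact: cvg_cst.
    apply: cvg_big => [|t _]; first exact: add_continuous.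
    have c1 : average (koopman a) (F k) f (x n) @[k --> \oo] --> integral_signed f (L (d n)).
      have c0 := (weak_star_cvgP _ _).1 (HL (d n) (ds n)) f.
      by under eq_fun do rewrite -dE -integral_signed_average; exact: c0.
    have cv : cvgn (fun k => average (koopman a) (right_translate t (F k)) f (x n)).
      by apply: pointwise; exact: left_folner_right_translate.
    have c2 : average (koopman a) (right_translate t (F k)) f (x n) @[k --> \oo] -->
      limn (fun k => average (koopman a) (right_translate t (F k)) f (x n)) by [].
    have limE : limn (fun k => average (koopman a) (right_translate t (F k)) f (x n)) =
        integral_signed f (L (d n)).
      have ptw G' : left_folner R G' -> cvgn (fun k => average (koopman a) (G' k) f (x n)).
        exact: pointwise.
      exact: (folner_limit_unique (u := fun A => average (koopman a) A f (x n))
        (@Rhausdorff R) ptw (left_folner_right_translate bc t fF) fF c2 c1).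
    rewrite -limE.
    have E' k : average (koopman a) (F k) f (a t (x n)) =
        average (koopman a) (right_translate t (F k)) f (x n).
      by rewrite -koopman_average_right_translate.
    by under eq_fun do rewrite E'; exact: c2.
  exact: (cvg_unique hM c c').
have key H eta1 : left_folner R H -> folner_limit a H x U eta1 ->
    L (d n) @[n --> U] --> eta1.
  move=> fH etaH; have c : average (koopman_dual a) (H n) (d n) @[n --> U] --> eta1.
    exact: average_koopman_dual_limit.
  rewrite -(Lfix _ _ etaH); under eq_fun do rewrite -(Laverage H _ fH).
  apply: within_ultra_limit => //; last by have [] := etaH.
  by move=> n; apply: subprobabilities_average => //; have [] := fH.
exact: (cvg_unique hM (key _ _ fF etaF) (key _ _ fG etaG)).
Qed.

(** The limits of averages of a single point mass; they are the candidates for the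
    invariant probability on the orbit closure. *)
Section orbit_limits.
Variables (F : nat -> {fset S}) (x : X) (U : set_system nat) (eta : signed_measure X).
Hypotheses (fF : left_folner R F) (UU : UltraFilter U)
  (etaF : folner_limit a F (fun=> x) U eta)
  (etaV : forall V c, open V ->
    (forall f, subordinate f V -> integral_signed f eta <= c) -> eta V <= c).

Let E := orbit_closure a x.

Lemma orbit_in_closure s : E (a s x).
Proof. by apply: subset_closure; exists s. Qed.

Lemma integral_constant_on_orbit f (c : R) : (forall y, E y -> f y = c) ->
  integral_signed f eta = c.
Proof.
move=> fE; have [_ _ _ /(_ f) lim] := etaF.
have lim' : average (koopman a) (F n) f x @[n --> U] --> c.
  have AE n : average (koopman a) (F n) f x = c.
    rewrite average_koopmanE (eq_bigr (fun=> c)) => [|t _]; last first.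
      by rewrite fE//; exact: orbit_in_closure.
    by rewrite fset_mean_cstR//; have [] := fF.
  by under eq_fun do rewrite AE; exact: cvg_cst.
exact: (cvg_unique (@Rhausdorff R) lim lim').
Qed.

Lemma orbit_limit_support : eta (~` E) = 0.
Proof.
have [eta0 _ _ _] := etaF; apply/eqP; rewrite eq_le eta0 andbT; apply: etaV.
  by apply: closed_openC; exact: closed_closure.
move=> f [_ fE]; rewrite (@integral_constant_on_orbit f 0)// => y Ey.
by apply: fE; apply.
Qed.

Lemma orbit_limit_mass : compact E -> eta setT = 1.
Proof.
move=> cE; have [eta0 eta1 _ _] := etaF; apply/eqP; rewrite eq_le eta1 /=.
have [g [g01 gE _]] := C0_urysohn lcX cE openT (@subsetT _ E).
rewrite -(@integral_constant_on_orbit g 1)//.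
rewrite -[leRHS]mul1r -integral_signed_cst//; apply: le_integral_signed => //.
- exact: C0_bounded_measurable.
- exact: bounded_measurable_cst.
- by move=> y; have /andP[] := g01 y.
Qed.

(** If the orbit closure is compact, [eta] is an invariant probability on it,
    hence the only one.  Otherwise a positive mass could be normalized to give
    an invariant probability where there is none. *)
Lemma orbit_limit_ergodic_map : pointwise_uniquely_ergodic a -> eta = ergodic_map a x.
Proof.
move=> /(_ x)[esc nesc]; have [eta0 eta1 etafix _] := etaF.
rewrite /ergodic_map; case: asboolP => [/esc inv0|/[dup] nx /nesc [mu invE]]; last first.
  have cE : compact E by exact: contrapT.
  have : invariant_probabilities a E eta.
    by split=> //; [split=> //; exact: orbit_limit_mass|exact: orbit_limit_support].
  rewrite -/E invE => /= ->; apply/esym; exact: xget_unique.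
have m0 : eta setT = 0.
  apply: contrapT => /eqP m0; have mpos : 0 < eta setT by rewrite lt_def m0 eta0.
  suff : invariant_probabilities a E ((eta setT)^-1 *: eta) by rewrite -/E inv0.
  split.
  - split=> [A|]; first by change (0 <= (eta setT)^-1 * eta A); rewrite mulr_ge0 ?invr_ge0.
    by change ((eta setT)^-1 * eta setT = 1); rewrite mulVf.
  - move=> s; have := koopman_dual_linear a s ((eta setT)^-1) eta 0.
    by rewrite koopman_dual0 !addr0 etafix.
  - by change ((eta setT)^-1 * eta (~` E) = 0); rewrite orbit_limit_support mulr0.
apply: integral_signed_eq0 => // f; apply/eqP; rewrite -normr_eq0 eq_le normr_ge0 andbT.
by rewrite (le_trans (integral_signed_norm_le f eta0))// m0 mulr0.
Qed.

End orbit_limits.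

(** Pointwise convergence of the averages to Phi f is checked along ultrafilters,
    where the limit measure is Phi(x) by [orbit_limit_ergodic_map].  Applied to
    F_n and F_n s it shows that Phi f is invariant. *)
Theorem uniform_of_continuously_pointwise_ergodic :
  continuously_pointwise_ergodic a -> vanishes_at_infinity a -> uniform_action a.
Proof.
move=> [pue _] van; pose Phi f : C0 R X := mkC0 (van f).
have PhiE f x : Phi f x = integral_signed f (ergodic_map a x) by [].
have lim F f x : left_folner R F -> average (koopman a) (F n) f x @[n --> \oo] --> Phi f x.
  move=> fF; apply: cvg_ultra => U UU Uoo.
  have [eta etaF etaV] := folner_limit_exists a bc lcX (fun=> x) fF UU Uoo.
  rewrite PhiE -(orbit_limit_ergodic_map fF UU etaF etaV pue).
  by have [_ _ _] := etaF; apply.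
apply: uniform_of_unique_limits => // F G x U eta eta' fF fG UU etaF etaG.
have Phifix f : koopman_fix a (Phi f).
  move=> s; apply: C0_ext => y; rewrite -[LHS]/(Phi f (a s y)).
  have c1 : average (koopman a) (F n) f (a s y) @[n --> \oo] --> Phi f (a s y) by exact: lim.
  have c2 : average (koopman a) (right_translate s (F n)) f y @[n --> \oo] --> Phi f y.
    by apply: (lim (fun n => right_translate s (F n))); exact: left_folner_right_translate.
  have AE n : average (koopman a) (right_translate s (F n)) f y =
      average (koopman a) (F n) f (a s y).
    by rewrite -koopman_average_right_translate.
  have c3 : average (koopman a) (F n) f (a s y) @[n --> \oo] --> Phi f y.
    by under eq_fun do rewrite -AE; exact: c2.
  exact: (cvg_unique (@Rhausdorff R) c1 c3).
have inv H eta1 f : left_folner R H -> folner_limit a H x U eta1 ->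
    Phi f (x n) @[n --> U] --> integral_signed f eta1.
  move=> fH [e0 e1 efix elim].
  have -> : integral_signed f eta1 = integral_signed (Phi f) eta1.
    have c1 : integral_signed (average (koopman a) (H n) f) eta1 @[n --> \oo] -->
        integral_signed (Phi f) eta1.
      apply: (@integral_signed_dominated _ _ eta1 _ _ `|f|).
      - by move=> n; exact: C0_bounded_measurable.
      - exact: C0_bounded_measurable.
      - by move=> n y; rewrite (le_trans (C0_le_norm _ _))//; exact: average_koopman_norm.
      - by move=> y; exact: lim.
    have E n : average (koopman_dual a) (H n) eta1 = eta1.
      by apply: average_fixed => //; have [] := fH.
    have c2 : integral_signed (average (koopman a) (H n) f) eta1 @[n --> \oo] -->
        integral_signed f eta1.
      by under eq_fun do rewrite -integral_signed_average E; exact: cvg_cst.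
    exact: (cvg_unique (@Rhausdorff R) c2 c1).
  have AE n : average (koopman a) (H n) (Phi f) = Phi f by exact: average_koopman_fix.
  by have := elim (Phi f); under eq_fun do rewrite AE; apply.
apply: signed_measure_ext => // f.
exact: (cvg_unique (@Rhausdorff R) (inv _ _ f fF etaF) (inv _ _ f fG etaG)).
Qed.

(** The measure attached to x is the one representing f |-> P f(x).  It is
    obtained as a limit of averaged point masses, which locates its support in
    the orbit closure and, if that is compact, gives it mass 1. *)
Theorem pointwise_ergodic_of_uniform : left_amenable S R -> uniform_action a ->
  continuously_pointwise_ergodic a /\ vanishes_at_infinity a.
Proof.
move=> [F fF] ua; have [P [[PC PP rP kerP] HP]] := uniform_projection bc ua fF.
have Pfix f s x : P f (a s x) = P f x.
  have : koopman_fix a (P f) by rewrite -rP; exists f.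
  by move=> /(_ s)/(congr1 (fun g : C0 R X => g x)).
have [U [UU Uoo]] := ultra_nat_exists.
have cE x : closed (orbit_closure a x) by exact: closed_closure.
have Pconst f x y : orbit_closure a x y -> P f y = P f x.
  have cl : closed [set y | P f y = P f x].
    have := @closed_eq R (P f x); have /continuous_closedP := @C0_continuous _ _ (P f).
    by move=> H /H.
  suff : orbit_closure a x `<=` [set y | P f y = P f x] by apply.
  by rewrite ((closure_id _).1 cl); apply: closure_subset => _ [s _ <-] /=; exact: Pfix.
have Pcompact f x : P f x != 0 -> compact (orbit_closure a x).
  move=> Pfx; have [_ vP] := C0P (P f).
  apply: (subclosed_compact (cE x) (vP `|P f x| _)); first by rewrite normr_gt0.
  by move=> y /(Pconst f) /= ->.
have invE x nu f : invariant_probabilities a (orbit_closure a x) nu ->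
    integral_signed f nu = P f x.
  move=> [[nu0 nu1] nufix nuE]; rewrite (integral_projection_fix fF HP f nufix).
  rewrite (integral_signed_constant nu0 (cE x) nuE (c := P f x)) ?nu1 ?mulr1//.
  exact: Pconst.
have etaP x : exists eta, (forall f, integral_signed f eta = P f x) /\
    (compact (orbit_closure a x) -> invariant_probabilities a (orbit_closure a x) eta).
  have [eta etaF etaV] := folner_limit_exists a bc lcX (fun=> x) fF UU Uoo.
  exists eta; split=> [f|cEx].
    have [_ _ _ /(_ f) c1] := etaF.
    have c2 : average (koopman a) (F n) f x @[n --> U] --> P f x.
      have c : average (koopman a) (F n) f x @[n --> \oo] --> P f x by apply: C0_eval_cvg.
      by move=> A /c; exact: Uoo.
    exact: (cvg_unique (@Rhausdorff R) c1 c2).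
  have [eta0 _ etafix _] := etaF; split=> //.
    by split=> //; exact: (orbit_limit_mass fF UU etaF).
  exact: (orbit_limit_support fF UU etaF etaV).
have pue : pointwise_uniquely_ergodic a.
  move=> x; split=> [esc|/contrapT cEx].
    apply/seteqP; split=> // nu inv; apply: esc; apply: contrapT => nc.
    have nu00 : nu = 0.
      apply: integral_signed_eq0 => // f; rewrite (invE x nu f inv).
      by apply: contrapT => /eqP /Pcompact.
    have [[_ nu1] _ _] := inv; move/eqP: nu1; rewrite nu00.
    by change ((0 : R) == 1 -> False); rewrite eq_sym oner_eq0.
  have [eta [etaE /(_ cEx) inv]] := etaP x; exists eta; apply/seteqP; split=> [nu nuinv|_ ->//].
  by apply: signed_measure_ext => // f; rewrite etaE; exact: invE.
have ergE x f : integral_signed f (ergodic_map a x) = P f x.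
  rewrite /ergodic_map; case: asboolP => [esc|/contrapT cEx].
    rewrite integral_signed0; last exact: C0_bounded_measurable.
    by apply/esym; apply: contrapT => /eqP /Pcompact.
  have [eta [etaE /(_ cEx) inv]] := etaP x.
  by apply: invE; exact: (xgetI _ inv).
split.
  split=> // x; apply: (weak_star_cvgP (FF := nbhs_filter x) (ergodic_map a) _).2 => f.
  by under eq_fun do rewrite ergE; rewrite ergE; exact: (@C0_continuous _ _ (P f)).
move=> f; rewrite (_ : (fun x => _) = P f); first exact: C0P.
by apply/funext => x; rewrite ergE.
Qed.

End ergodic.

Theorem theorem5p4 (R : realType) (S : semigroupType) (X : pmetricType R)
    (a : proper_action S X)
    (countableS : countable [set: S])
    (bicancellativeS : bicancellative S)
    (amenableS : left_amenable S R)
    (separableX : separable_space X)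
    (locally_compactX : locally_compact [set: X]) :
  let cond1 := continuously_pointwise_ergodic a /\ vanishes_at_infinity a in
  let cond2 := is_direct_sum (koopman_fix a) (closure (koopman_cob a)) in
  let cond3 := uniform_action a in
  let cond4 :=
    is_direct_sum (koopman_dual_fix a) (closure (koopman_dual_cob a)) in
  let cond5 := weak_star_mean_continuous a in
  [<-> cond1; cond2; cond3; cond4; cond5] /\
  forall F : nat -> {fset S}, left_folner R F ->
    cond1 \/ cond2 \/ cond3 \/ cond4 \/ cond5 ->
    exists (P : {linear C0 R X -> C0 R X})
           (Pdual : {linear signed_measure X -> signed_measure X}),
      [/\ is_mean_ergodic_projection a P,
          is_adjoint P Pdual,
          forall f : C0 R X, average (koopman a) (F n) f @[n --> \oo] --> P f,
          range Pdual `<=` koopman_dual_fix a &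
          forall nu : signed_measure X,
            average (koopman_dual a) (F n) nu @[n --> \oo] --> Pdual nu].
Proof.
move=> cond1 cond2 cond3 cond4 cond5.
have c13 : cond1 -> cond3.
  by move=> [h1 h2]; exact: uniform_of_continuously_pointwise_ergodic.
have c31 : cond3 -> cond1 by exact: pointwise_ergodic_of_uniform.
have c23 : cond2 -> cond3 by exact: uniform_of_direct_sum.
have c32 : cond3 -> cond2 by exact: direct_sum_of_uniform.
have c43 : cond4 -> cond3 by move=> [_ h]; exact: uniform_of_dual_direct_sum.
have c34 : cond3 -> cond4 by exact: dual_direct_sum_of_uniform.
have c53 : cond5 -> cond3 by exact: uniform_of_weak_star_mean_continuous.
have c35 : cond3 -> cond5 by exact: weak_star_mean_continuous_of_uniform.
split; first by tfae=> [/c13/c32|/c23|/c34|/c43/c35|/c53/c31].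
move=> F fF conds; have ua : cond3.
  by case: conds => [/c13|[/c23|[|[/c43|/c53]]]].
have [P [Pproj HP]] := uniform_projection bicancellativeS ua fF.
have [Q [adj Qfix HQ]] := dual_projection bicancellativeS locally_compactX fF HP.
by exists P, Q.
Qed.
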